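(* Let $(\phi_h,\mu_h,\theta_h,\mathbf{u}_h,\pi_h)$, with $(\phi_h,\mathbf{u}_h,\theta_h)\in\Pi^1_c(\mathcal{I}_\tau;\mathcal{V}_h\times\mathcal{X}_h\times\mathcal{V}_h^+)$ and $(\mu_h,\pi_h)\in\Pi^0(\mathcal{I}_\tau;\mathcal{V}_h\times\mathcal{V}_h)$, be any solution of the fully discrete scheme for the non-isothermal Cahn-Hilliard-Navier-Stokes system (written out in full in the context) with initial values $(\phi_h^0,\mathbf{u}_h^0,\theta_h^0)=(\phi_{h,0},\mathbf{u}_{h,0},\theta_{h,0})\in\mathcal{V}_h\times\mathcal{X}_h\times\mathcal{V}_h^+$. Then for every $n\in\{0,\dots,n_T-1\}$ the following hold. (Conservation of mass) $\langle \phi_h^{n+1}-\phi_h^0,1\rangle=0$. (Conservation of total energy) $\langle \tfrac12|\mathbf{u}_h^{n+1}|^2+e(\phi_h^{n+1},\theta_h^{n+1})-\tfrac12|\mathbf{u}_h^0|^2-e(\phi_h^0,\theta_h^0),1\rangle=0$. (Entropy production) $$\langle s(\phi_h^{n+1},\theta_h^{n+1})-s(\phi_h^0,\theta_h^0),1\rangle=\tau\sum_{k=0}^{n}\mathcal{D}^{k+1}+\sum_{k=0}^{n}\mathcal{D}_{num}^{k+1},$$ where $$\mathcal{D}^{k+1}=\big\|\sqrt{\eta^*\theta_h^{k+1}}\,\mathrm{D}\mathbf{u}_h^{k+1/2}\big\|_0^2+\big\langle(\nabla\mu_h^{k+1},\nabla\theta_h^{k+1})^\top,\mathbf{L}^*(\nabla\mu_h^{k+1},\nabla\theta_h^{k+1})^\top\big\rangle$$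 (with $\eta^*,\mathbf{L}^*$ those of the $k$-th time step, i.e. the step from $t^k$ to $t^{k+1}$), and the numerical dissipation satisfies $\mathcal{D}_{num}^{k+1}\ge 0$ and is given by $$\begin{aligned}\mathcal{D}_{num}^{k+1}={}&\tfrac{\gamma}{2}\|\nabla d^{k+1}\phi_h\|_0^2+\int_\Omega\Big[-\partial_{\theta\theta}\Psi(\phi_h^k,\xi_h^3)(d^{k+1}\theta_h)^2+\big(\partial_{\phi\phi}\Psi_{vex}(\xi_h^1,\theta_h^{k+1})-\partial_{\phi\phi}\Psi_{cav}(\xi_h^2,\theta_h^{k+1})\big)(d^{k+1}\phi_h)^2\Big]\\&+\tau\varepsilon\big\|\sqrt{\theta_h^{k+1}}\,\mathrm{div}(\mathbf{u}_h^{k+1/2})\big\|_0^2+\tau\delta\big\|h\sqrt{\theta_h^{k+1}}\,\nabla\pi_h^{k+1}\big\|_0^2,\end{aligned}$$ where $\xi_h^1,\xi_h^2,\xi_h^3$ are functions on $\Omega$ (depending on $k$) such that $\xi_h^1,\xi_h^2$ are (pointwise) convex combinations of $\phi_h^{k}$ and $\phi_h^{k+1}$ and $\xi_h^3$ is a (pointwise) convex combination of $\theta_h^{k}$ and $\theta_h^{k+1}$.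
   Context: **Domain and notation.** $d\in\{2,3\}$; $\Omega\subset\mathbb{R}^d$ is a cube identified with the $d$-dimensional torus, and all functions on $\Omega$ are periodic. $\langle u,v\rangle=\int_\Omega u\cdot v$ (also for vector- and matrix-valued functions), $\|u\|_0^2=\int_\Omega|u|^2$. $\mathrm{D}\mathbf{u}=\tfrac12(\nabla\mathbf{u}+\nabla\mathbf{u}^\top)$ is the symmetric gradient. With $\mathbf{c}(\mathbf{u},\mathbf{v},\mathbf{w})=\langle(\mathbf{u}\cdot\nabla)\mathbf{v},\mathbf{w}\rangle$, set $\mathbf{c}_{skw}(\mathbf{u},\mathbf{v},\mathbf{w})=\tfrac12\mathbf{c}(\mathbf{u},\mathbf{v},\mathbf{w})-\tfrac12\mathbf{c}(\mathbf{u},\mathbf{w},\mathbf{v})$. $\mathbb{R}_+=(0,\infty)$. **Data and standing assumptions.** - $\gamma>0$ is a constant. - The viscosity $\eta=\eta(\phi,\theta)$ is a strictly positive (continuous) function. - The diffusion matrix $\mathbf{L}=\mathbf{L}(\phi,\nabla\phi,\theta)=\begin{pmatrix}\mathbf{L}_{11}&-\mathbf{L}_{12}\\-\mathbf{L}_{12}&\mathbf{L}_{22}\end{pmatrix}\in\mathbb{R}^{2d\times2d}$ (with $d\times d$ blocks) is symmetric, strictly positive definite (and continuous in its arguments). - The potential $\Psi:\mathbb{R}\times\mathbb{R}_+\to\mathbb{R}$, $(\phi,\theta)\mapsto\Psi(\phi,\theta)$, is such that for fixed $\phi$ the function $\Psi(\phi,\cdot)$ is concave and tends to $-\infty$ as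 $\theta\to0$; for fixed $\theta$ there is a decomposition $\Psi(\cdot,\theta)=\Psi_{vex}(\cdot,\theta)+\Psi_{cav}(\cdot,\theta)$ into a strictly convex part $\Psi_{vex}$ and a strictly concave part $\Psi_{cav}$. $\Psi$, $\Psi_{vex}$, $\Psi_{cav}$ are smooth enough (twice continuously differentiable) for the derivatives appearing to make sense. - $\theta$ is the inverse temperature. The internal energy is $e(\phi,\theta)=\partial_\theta\Psi(\phi,\theta)$ and the entropy is $s(\phi,\theta)=\theta e(\phi,\theta)-\Psi(\phi,\theta)-\tfrac{\gamma}{2}|\nabla\phi|^2$. The Korteweg stress is $\boldsymbol{\sigma}=\tfrac{\gamma}{\theta}\nabla\phi\otimes\nabla\phi$. - $\varepsilon,\delta>0$ are stabilisation parameters (they may depend on $h$). **Time discretization.** $T>0$ and $[0,T]$ is divided uniformly with step $\tau>0$; $\mathcal{I}_\tau=\{t^0=0,t^1=\tau,\dots,t^{n_T}=T\}$, $n_T=T/\tau$. $\Pi^1_c(\mathcal{I}_\tau;X)$ and $\Pi^0(\mathcal{I}_\tau;X)$ are the continuous piecewise-linear, respectively piecewise-constant, functions of time on $\mathcal{I}_\tau$ with values in $X$. For $g\in\Pi^1_c$, $g^n=g(t^n)$ and $g^{n+1/2}=(g^{n+1}+g^n)/2$; for $g\in\Pi^0$, $g^{n+1}$ is its value on the interval from $t^n$ to $t^{n+1}$. Further $d^{n+1}g=g^{n+1}-g^n$ and $d_\tau^{n+1}g=\tau^{-1}d^{n+1}g$. For $e$ and $s$: $e_h^n=e(\phi_h^n,\theta_h^n)$,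 $s_h^n=s(\phi_h^n,\theta_h^n)$, $d_\tau^{n+1}e_h=\tau^{-1}(e_h^{n+1}-e_h^n)$. **Starred quantities.** In each time step, a superscript $*$ denotes evaluation at some time $t^*\in[t^n,t^{n+1}]$, the same for all starred quantities of that step: $\phi_h^*=\phi_h(t^* )$, $\theta_h^*=\theta_h(t^* )$, $\mathbf{u}_h^*=\mathbf{u}_h(t^* )$, $\mu_h^*=\mu_h(t^* )$ (when $t^*=t^n$, $\mu_h^*=\mu_h^n$, with some given $\mu_h^0\in\mathcal{V}_h$ for $n=0$), and $\eta^*,\mathbf{L}^*,s_h^*,\boldsymbol{\sigma}_h^*$ are $\eta,\mathbf{L},s,\boldsymbol{\sigma}$ evaluated at $\phi_h^*,\theta_h^*$ (and $\nabla\phi_h^*$ where needed). **Space discretization.** $\mathcal{T}_h$ is a geometrically conforming partition of $\Omega$ into simplices that can be extended periodically, with mesh size $h>0$. $\mathcal{V}_h=\{v\in H^1(\Omega)\cap C^0(\bar\Omega): v|_K\in P_1(K)\ \forall K\in\mathcal{T}_h\}$ (periodic), $\mathcal{X}_h=\mathcal{V}_h^d$, $\mathcal{V}_h^+=\{v\in\mathcal{V}_h: v(x)>0\ \forall x\in\Omega\}$. **Convex-concave splitting.** $\Psi(\phi_h^{n+1},\phi_h^n,\theta_h^{n+1})=\Psi_{vex}(\phi_h^{n+1},\theta_h^{n+1})+\Psi_{cav}(\phi_h^n,\theta_h^{n+1})$, and correspondingly $\partial_\phi\Psi(\phi_h^{n+1},\phi_h^n,\theta_h^{n+1})=\partial_\phi\Psi_{vex}(\phi_h^{n+1},\theta_h^{n+1})+\partial_\phi\Psi_{cav}(\phi_h^n,\theta_h^{n+1})$.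 **The fully discrete scheme.** Given $(\phi_{h,0},\mathbf{u}_{h,0},\theta_{h,0})\in\mathcal{V}_h\times\mathcal{X}_h\times\mathcal{V}_h^+$, a solution consists of $(\phi_h,\mathbf{u}_h,\theta_h)\in\Pi^1_c(\mathcal{I}_\tau;\mathcal{V}_h\times\mathcal{X}_h\times\mathcal{V}_h^+)$ with these initial values and $(\mu_h,\pi_h)\in\Pi^0(\mathcal{I}_\tau;\mathcal{V}_h\times\mathcal{V}_h)$ such that for all $n=0,\dots,n_T-1$ and all $(\psi_h,\xi_h,w_h,\mathbf{v}_h,q_h)\in\mathcal{V}_h\times\mathcal{V}_h\times\mathcal{V}_h^+\times\mathcal{X}_h\times\mathcal{V}_h$: (1) $\langle d_\tau^{n+1}\phi_h,\psi_h\rangle-\langle\phi_h^*\mathbf{u}_h^{n+1/2},\nabla\psi_h\rangle+\langle\mathbf{L}_{11}^*\nabla\mu_h^{n+1}-\mathbf{L}_{12}^*\nabla\theta_h^{n+1},\nabla\psi_h\rangle=0$; (2) $\langle\mu_h^{n+1},\xi_h\rangle-\gamma\langle\nabla\phi_h^{n+1},\nabla\xi_h\rangle-\langle\partial_\phi\Psi(\phi_h^{n+1},\phi_h^n,\theta_h^{n+1}),\xi_h\rangle=0$; (3) $\langle d_\tau^{n+1}e_h,w_h\rangle+\langle\mathbf{L}_{12}^*\nabla\mu_h^{n+1}-\mathbf{L}_{22}^*\nabla\theta_h^{n+1},\nabla w_h\rangle-\langle\eta^*|\mathrm{D}\mathbf{u}_h^{n+1/2}|^2,w_h\rangle-\varepsilon\langle|\mathrm{div}(\mathbf{u}_h^{n+1/2})|^2,w_h\rangle-\delta\langle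 h^2|\nabla\pi_h^{n+1}|^2,w_h\rangle-\langle\boldsymbol{\sigma}_h^*\mathbf{u}_h^{n+1/2},\nabla w_h\rangle-\big\langle\tfrac{\phi_h^*}{\theta_h^{n+1}}\nabla\mu_h^{n+1}-\boldsymbol{\sigma}_h^*\tfrac{\nabla\theta_h^{n+1}}{\theta_h^{n+1}},\mathbf{u}_h^{n+1/2}w_h\big\rangle-\big\langle(s_h^*+\phi_h^*\mu_h^* )\mathbf{u}_h^{n+1/2},\tfrac{\theta_h^{n+1}\nabla w_h-w_h\nabla\theta_h^{n+1}}{(\theta_h^* )^2}\big\rangle=0$; (4) $\langle d_\tau^{n+1}\mathbf{u}_h,\mathbf{v}_h\rangle+\mathbf{c}_{skw}(\mathbf{u}_h^*,\mathbf{u}_h^{n+1/2},\mathbf{v}_h)+\langle\eta^*\mathrm{D}\mathbf{u}_h^{n+1/2},\mathrm{D}\mathbf{v}_h\rangle+\varepsilon\langle\mathrm{div}(\mathbf{u}_h^{n+1/2}),\mathrm{div}(\mathbf{v}_h)\rangle-\langle\pi_h^{n+1},\mathrm{div}(\mathbf{v}_h)\rangle+\big\langle\tfrac{\phi_h^*}{\theta_h^{n+1}}\nabla\mu_h^{n+1}-\boldsymbol{\sigma}_h^*\tfrac{\nabla\theta_h^{n+1}}{\theta_h^{n+1}}-(s_h^*+\phi_h^*\mu_h^* )\tfrac{\nabla\theta_h^{n+1}}{(\theta_h^* )^2},\mathbf{v}_h\big\rangle=0$; (5) $\langle\mathrm{div}(\mathbf{u}_h^{n+1/2}),q_h\rangle=-\delta\langle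 h^2\nabla\pi_h^{n+1},\nabla q_h\rangle$.
   Formalization: In the numerical dissipation, the integral with the second derivatives of Ψ, Ψ_vex, Ψ_cav carries a factor 1/2 (from the Lagrange form of the second-order Taylor remainder) that is missing in the printed formula; without it the entropy identity fails in general. *)

(* Defs.v *)
From HB Require Import structures.
From mathcomp Require Import all_boot all_order all_algebra finmap.
From mathcomp Require Import all_classical all_reals all_analysis.

Set Implicit Arguments.
Unset Strict Implicit.
Unset Printing Implicit Defensive.

Import Order.TTheory GRing.Theory Num.Theory numFieldNormedType.Exports.

Local Open Scope classical_set_scope.
Local Open Scope ring_scope.

Section LebesgueTuple.
Context (R : realType).
Local Notation Rm := (measurableTypeR R).

Definition cons_tuple (n : nat) (z : n.-tuple Rm * Rm) : n.+1.-tuple Rm :=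
  [the n.+1.-tuple Rm of z.2 :: z.1].

Lemma measurable_cons_tuple (n : nat) : measurable_fun [set: _] (@cons_tuple n).
Proof. exact: measurable_cons. Qed.

(* The image of [m \x lebesgue_measure] under [cons_tuple].  The canonical
   measure structure on [pushforward] is named explicitly because unification
   cannot find its measurability argument. *)
Definition lebesgue_cons (n : nat) (m : {measure set (n.-tuple Rm) -> \bar R}) :
    {measure set (n.+1.-tuple Rm) -> \bar R} :=
  measure_function_pushforward__canonical__measure_function_Measure
    (m \x @lebesgue_measure R)%E (@measurable_cons_tuple n).

(* d-dimensional Lebesgue measure, as an iterated product measure. *)
Fixpoint lebesgue_tuple (n : nat) : {measure set (n.-tuple Rm) -> \bar R} :=
  match n with
  | 0%N => @dirac _ _ [tuple] R
  | m.+1 => lebesgue_cons (lebesgue_tuple m)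
  end.

End LebesgueTuple.

Section Euclidean.
Context (R : realType) (d : nat).
Local Notation V := 'rV[R]_d.

Definition dotv (n : nat) (x y : 'rV[R]_n) : R := \sum_i x 0 i * y 0 i.
Definition dotm (A B : 'M[R]_d) : R := \sum_i \sum_j A i j * B i j.
(* Vectors are rows; this is the product of [A] with [x] seen as a column. *)
Definition mulmv (n : nat) (A : 'M[R]_n) (x : 'rV[R]_n) : 'rV[R]_n :=
  (A *m x^T)^T.
Definition outer (x y : V) : 'M[R]_d := x^T *m y.
Definition enorm (x : V) : R := Num.sqrt (dotv x x).

Definition basis (i : 'I_d) : V := delta_mx 0 i.

(* Classical partial derivatives.  For a continuous piecewise affine function
   they exist off the mesh skeleton, a null set, and represent the weak ones. *)
Definition grad (v : V -> R) (x : V) : V := \row_i ('D_(basis i) v x).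
(* Entry (i, j) is the j-th partial derivative of the i-th component. *)
Definition gradv (u : V -> V) (x : V) : 'M[R]_d :=
  \matrix_(i, j) ('D_(basis j) (fun y => u y 0 i) x).
Definition symgrad (u : V -> V) (x : V) : 'M[R]_d :=
  2^-1 *: (gradv u x + (gradv u x)^T).
Definition divg (u : V -> V) (x : V) : R := \tr (gradv u x).
(* (u . grad) v *)
Definition advect (u v : V -> V) (x : V) : V := mulmv (gradv v x) (u x).

End Euclidean.

Section Mesh.
Context (R : realType) (d : nat).
Local Notation V := 'rV[R]_d.

(* The cube with lower corner [a] and side [l], i.e. a fundamental cell of the
   torus.  A function on the torus is an [l]-periodic function on R^d. *)
Definition cube (a : V) (l : R) : set V :=
  [set x | forall i, a 0 i <= x 0 i <= a 0 i + l].

Definition cube_periodic (W : zmodType) (l : R) (v : V -> W) : Prop :=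
  forall i : 'I_d, periodic v (l *: basis R i).

(* A simplex is represented by the finite set of its vertices. *)
Definition hull (K : {fset V}) : set V :=
  [set x | exists w : V -> R,
    [/\ forall p, p \in K -> 0 <= w p,
        \sum_(p <- K) w p = 1
      & x = \sum_(p <- K) w p *: p]].

Definition affinely_independent (K : {fset V}) : Prop :=
  forall w : V -> R,
    \sum_(p <- K) w p = 0 -> \sum_(p <- K) w p *: p = 0 ->
    forall p, p \in K -> w p = 0.

Definition simplex (K : {fset V}) : Prop :=
  #|` K| = d.+1 /\ affinely_independent K.

Definition translate (z : V) (K : {fset V}) : {fset V} :=
  [fset (p + z)%R | p in K]%fset.

Definition lattice_vector (l : R) (k : 'rV[int]_d) : V :=
  l *: map_mx (fun m : int => m%:~R) k.

(* Conformity is required between all lattice translates of the elements, so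
   that the periodic extension of the partition is conforming as well; k = 0
   gives conformity inside the cube. *)
Definition periodic_conforming_mesh (a : V) (l : R) (T : {fset {fset V}}) :
    Prop :=
  [/\ forall K, K \in T -> simplex K,
      cube a l = [set x | exists2 K, K \in T & hull K x]
    & forall K K' (k : 'rV[int]_d), K \in T -> K' \in T ->
        let K'' := translate (lattice_vector l k) K' in
        hull K `&` hull K'' = hull (K `&` K'')%fset].

(* Largest diameter of an element. *)
Definition mesh_size (T : {fset {fset V}}) : R :=
  \big[Num.max/0]_(K <- T) \big[Num.max/0]_(p <- K) \big[Num.max/0]_(q <- K)
    enorm (p - q).

Definition affine_on (S : set V) (v : V -> R) : Prop :=
  exists (c : V) (b : R), forall x, S x -> v x = dotv c x + b.

(* Continuous piecewise affine functions belong to H^1, so that membership is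
   not repeated. *)
Definition Vh (l : R) (T : {fset {fset V}}) : set (V -> R) :=
  [set v | [/\ continuous v, cube_periodic l v
             & forall K, K \in T -> affine_on (hull K) v]].

Definition Xh (l : R) (T : {fset {fset V}}) : set (V -> V) :=
  [set u | forall i, Vh l T (fun x => u x 0 i)].

Definition Vh_pos (l : R) (T : {fset {fset V}}) : set (V -> R) :=
  [set v | Vh l T v /\ forall x, 0 < v x].

End Mesh.

Section Time.
Context (R : realType) (tau : R).

Definition node (W : Type) (g : R -> W) (n : nat) : W := g (n%:R * tau).

(* Linearity on closed subintervals includes continuity at the nodes. *)
Definition Pi1c (W : lmodType R) (nT : nat) (S : set W) (g : R -> W) : Prop :=
  (forall t, 0 <= t <= nT%:R * tau -> S (g t)) /\
  forall n, (n < nT)%N -> forall t, n%:R * tau <= t <= n.+1%:R * tau ->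
    g t = ((n.+1%:R * tau - t) / tau) *: node g n
        + ((t - n%:R * tau) / tau) *: node g n.+1.

(* Left-open subintervals: [node g n.+1] is the value on ]t^n, t^n+1]. *)
Definition Pi0 (W : Type) (nT : nat) (S : set W) (g : R -> W) : Prop :=
  forall n, (n < nT)%N ->
    S (node g n.+1) /\
    forall t, n%:R * tau < t <= n.+1%:R * tau -> g t = node g n.+1.

Definition dnode (V : Type) (W : zmodType) (g : R -> V -> W) (n : nat) (x : V) :
    W := node g n.+1 x - node g n x.

Definition midnode (V : Type) (W : lmodType R) (g : R -> V -> W) (n : nat)
    (x : V) : W := 2^-1 *: (node g n.+1 x + node g n x).

End Time.

Section Constitutive.
Context (R : realType).

Definition dfst (F : R -> R -> R) (p t : R) : R :=
  derive1 (fun q => F q t) p.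
Definition dsnd (F : R -> R -> R) (p t : R) : R := derive1 (F p) t.

(* Regularity on R x ]0, +oo[. *)
Definition C1_pos (F : R -> R -> R) : Prop :=
  forall p t : R, 0 < t ->
    [/\ derivable (fun q => F q t) p 1, derivable (F p) t 1,
        {for (p, t), continuous (fun z : R * R => F z.1 z.2)},
        {for (p, t), continuous (fun z : R * R => dfst F z.1 z.2)}
      & {for (p, t), continuous (fun z : R * R => dsnd F z.1 z.2)}].

Definition C2_pos (F : R -> R -> R) : Prop :=
  [/\ C1_pos F, C1_pos (dfst F) & C1_pos (dsnd F)].

Definition concave_pos (f : R -> R) : Prop :=
  forall s t l : R, 0 < s -> 0 < t -> 0 <= l <= 1 ->
    l * f s + (1 - l) * f t <= f (l * s + (1 - l) * t).

Definition strictly_convex (f : R -> R) : Prop :=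
  forall p q l : R, p != q -> 0 < l < 1 ->
    f (l * p + (1 - l) * q) < l * f p + (1 - l) * f q.

Definition strictly_concave (f : R -> R) : Prop :=
  strictly_convex (fun p => - f p).

(* Constitutive functions, to be read for inverse temperatures theta > 0 only: arguments
   are (phi, theta), resp. (phi, grad phi, theta). *)
Record model (d : nat) := Model {
  gam : R;
  eta : R -> R -> R;
  L11 : R -> 'rV[R]_d -> R -> 'M[R]_d;
  L12 : R -> 'rV[R]_d -> R -> 'M[R]_d;
  L22 : R -> 'rV[R]_d -> R -> 'M[R]_d;
  Psi : R -> R -> R;
  Psi_vex : R -> R -> R;
  Psi_cav : R -> R -> R
}.

Definition Lmat (d : nat) (M : model d) (p : R) (g : 'rV[R]_d) (t : R) :
    'M[R]_(d + d) :=
  block_mx (L11 M p g t) (- L12 M p g t) (- L12 M p g t) (L22 M p g t).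

Record model_assumptions (d : nat) (M : model d) : Prop := ModelAssumptions {
  gam_gt0 : 0 < gam M;
  eta_gt0 : forall p t, 0 < t -> 0 < eta M p t;
  eta_cont : forall p t, 0 < t ->
    {for (p, t), continuous (fun z : R * R => eta M z.1 z.2)};
  Lmat_sym : forall p g t, 0 < t -> (Lmat M p g t)^T = Lmat M p g t;
  Lmat_posdef : forall p g t, 0 < t -> forall y : 'rV[R]_(d + d), y != 0 ->
    0 < dotv y (mulmv (Lmat M p g t) y);
  Lmat_cont : forall p g t, 0 < t ->
    {for (p, g, t), continuous
      (fun z : R * 'rV[R]_d * R => Lmat M z.1.1 z.1.2 z.2)};
  Psi_concave : forall p, concave_pos (Psi M p);
  Psi_lim0 : forall p, Psi M p t @[t --> 0^'+] --> -oo;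
  Psi_split : forall p t, 0 < t -> Psi M p t = Psi_vex M p t + Psi_cav M p t;
  Psi_vex_convex : forall t, 0 < t -> strictly_convex (Psi_vex M ^~ t);
  Psi_cav_concave : forall t, 0 < t -> strictly_concave (Psi_cav M ^~ t);
  Psi_C2 : C2_pos (Psi M);
  Psi_vex_C2 : C2_pos (Psi_vex M);
  Psi_cav_C2 : C2_pos (Psi_cav M)
}.

Definition energy (d : nat) (M : model d) (phi theta : 'rV[R]_d -> R)
    (x : 'rV[R]_d) : R := dsnd (Psi M) (phi x) (theta x).

Definition entropy (d : nat) (M : model d) (phi theta : 'rV[R]_d -> R)
    (x : 'rV[R]_d) : R :=
  theta x * energy M phi theta x - Psi M (phi x) (theta x)
  - gam M / 2 * dotv (grad phi x) (grad phi x).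

Definition korteweg (d : nat) (M : model d) (phi theta : 'rV[R]_d -> R)
    (x : 'rV[R]_d) : 'M[R]_d :=
  (gam M / theta x) *: outer (grad phi x) (grad phi x).

(* Derivative in phi of Psi_vex(p1, t) + Psi_cav(p0, t), with the convex part
   at the new and the concave part at the old value. *)
Definition dphi_split (d : nat) (M : model d) (p1 p0 t : R) : R :=
  dfst (Psi_vex M) p1 t + dfst (Psi_cav M) p0 t.

End Constitutive.

Section InnerProducts.
Context (R : realType) (d : nat) (a : 'rV[R]_d) (l : R).
Local Notation V := 'rV[R]_d.

Definition tuple_row (t : d.-tuple (measurableTypeR R)) : V :=
  \row_i tnth t i.
Definition Omega : set (d.-tuple (measurableTypeR R)) :=
  [set t | cube a l (tuple_row t)].

Definition intO (f : V -> R) : R :=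
  \int[lebesgue_tuple R d]_(t in Omega) f (tuple_row t).
Definition integrableO (f : V -> R) : Prop :=
  (lebesgue_tuple R d).-integrable Omega (fun t => (f (tuple_row t))%:E).

Definition ips (f g : V -> R) : R := intO (fun x => f x * g x).
Definition ipv (n : nat) (f g : V -> 'rV[R]_n) : R :=
  intO (fun x => dotv (f x) (g x)).
Definition ipm (f g : V -> 'M[R]_d) : R := intO (fun x => dotm (f x) (g x)).

Definition c_conv (u v w : V -> V) : R := ipv (advect u v) w.
Definition c_skw (u v w : V -> V) : R :=
  2^-1 * c_conv u v w - 2^-1 * c_conv u w v.

End InnerProducts.

Section Scheme.
Context (R : realType) (d : nat) (M : model R d).
Local Notation V := 'rV[R]_d.
Context (a : V) (l : R) (Th : {fset {fset V}}) (eps delta : R).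
Context (tau : R) (nT : nat).
(* [ts n] is the evaluation time t^* of step n. *)
Context (ts : nat -> R).
Context (phi mu theta pi : R -> V -> R) (u : R -> V -> V).

Local Notation h := (mesh_size Th).
Local Notation "g ^[ n ]" := (node tau g n)
  (at level 2, n at level 50, format "g ^[ n ]").
Local Notation "<[ f , g ]>" := (ips a l f g).
Local Notation "<<[ f , g ]>>" := (ipv a l f g).
Local Notation "<<<[ f , g ]>>>" := (ipm a l f g).

Definition eta_star (n : nat) (x : V) : R :=
  eta M (phi (ts n) x) (theta (ts n) x).
Definition L11_star (n : nat) (x : V) : 'M[R]_d :=
  L11 M (phi (ts n) x) (grad (phi (ts n)) x) (theta (ts n) x).
Definition L12_star (n : nat) (x : V) : 'M[R]_d :=
  L12 M (phi (ts n) x) (grad (phi (ts n)) x) (theta (ts n) x).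
Definition L22_star (n : nat) (x : V) : 'M[R]_d :=
  L22 M (phi (ts n) x) (grad (phi (ts n)) x) (theta (ts n) x).
Definition Lmat_star (n : nat) (x : V) : 'M[R]_(d + d) :=
  Lmat M (phi (ts n) x) (grad (phi (ts n)) x) (theta (ts n) x).
Definition sigma_star (n : nat) (x : V) : 'M[R]_d :=
  korteweg M (phi (ts n)) (theta (ts n)) x.
(* s^* + phi^* mu^* *)
Definition s_phimu_star (n : nat) (x : V) : R :=
  entropy M (phi (ts n)) (theta (ts n)) x + phi (ts n) x * mu (ts n) x.

Definition energy_node (n : nat) : V -> R := energy M phi^[n] theta^[n].
Definition entropy_node (n : nat) : V -> R := entropy M phi^[n] theta^[n].

(* (phi^* / theta^n+1) grad mu^n+1 - sigma^* grad theta^n+1 / theta^n+1 *)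
Definition capillary_force (n : nat) (x : V) : V :=
  (phi (ts n) x / theta^[n.+1] x) *: grad mu^[n.+1] x
  - (theta^[n.+1] x)^-1 *: mulmv (sigma_star n x) (grad theta^[n.+1] x).

Local Notation um := (midnode tau u).

Definition phase_eq (n : nat) (psi : V -> R) : Prop :=
  <[ fun x => tau^-1 * dnode tau phi n x, psi ]>
  - <<[ fun x => phi (ts n) x *: um n x, grad psi ]>>
  + <<[ fun x => mulmv (L11_star n x) (grad mu^[n.+1] x)
                 - mulmv (L12_star n x) (grad theta^[n.+1] x), grad psi ]>>
  = 0.

Definition potential_eq (n : nat) (xi : V -> R) : Prop :=
  <[ mu^[n.+1], xi ]> - gam M * <<[ grad phi^[n.+1], grad xi ]>>
  - <[ fun x => dphi_split M (phi^[n.+1] x) (phi^[n] x) (theta^[n.+1] x), xi ]>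
  = 0.

Definition energy_eq (n : nat) (w : V -> R) : Prop :=
  <[ fun x => tau^-1 * (energy_node n.+1 x - energy_node n x), w ]>
  + <<[ fun x => mulmv (L12_star n x) (grad mu^[n.+1] x)
                 - mulmv (L22_star n x) (grad theta^[n.+1] x), grad w ]>>
  - <[ fun x => eta_star n x * dotm (symgrad (um n) x) (symgrad (um n) x), w ]>
  - eps * <[ fun x => divg (um n) x ^+ 2, w ]>
  - delta * <[ fun x => h ^+ 2 * dotv (grad pi^[n.+1] x) (grad pi^[n.+1] x),
               w ]>
  - <<[ fun x => mulmv (sigma_star n x) (um n x), grad w ]>>
  - <<[ capillary_force n, fun x => w x *: um n x ]>>
  - <<[ fun x => s_phimu_star n x *: um n x,
        fun x => (theta (ts n) x ^+ 2)^-1 *: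
          (theta^[n.+1] x *: grad w x - w x *: grad theta^[n.+1] x) ]>>
  = 0.

Definition momentum_eq (n : nat) (v : V -> V) : Prop :=
  <<[ fun x => tau^-1 *: dnode tau u n x, v ]>>
  + c_skw a l (u (ts n)) (um n) v
  + <<<[ fun x => eta_star n x *: symgrad (um n) x, symgrad v ]>>>
  + eps * <[ divg (um n), divg v ]>
  - <[ pi^[n.+1], divg v ]>
  + <<[ fun x => capillary_force n x
          - (s_phimu_star n x / theta (ts n) x ^+ 2) *: grad theta^[n.+1] x,
        v ]>>
  = 0.

Definition pressure_eq (n : nat) (q : V -> R) : Prop :=
  <[ divg (um n), q ]>
  = - delta * <<[ fun x => h ^+ 2 *: grad pi^[n.+1] x, grad q ]>>.

Record discrete_solution (phi0 theta0 : V -> R) (u0 : V -> V) : Prop :=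
  DiscreteSolution {
  phi_Pi1c : Pi1c tau nT (Vh l Th) phi;
  u_Pi1c : Pi1c tau nT (Xh l Th) u;
  theta_Pi1c : Pi1c tau nT (Vh_pos l Th) theta;
  mu_Pi0 : Pi0 tau nT (Vh l Th) mu;
  pi_Pi0 : Pi0 tau nT (Vh l Th) pi;
  (* The value at time 0 of the left-open piecewise constant function mu is
     the given mu_h^0; it is used only if t^* = 0 in the first step. *)
  mu_init : Vh l Th mu^[0];
  phi_init : phi^[0] = phi0;
  u_init : u^[0] = u0;
  theta_init : theta^[0] = theta0;
  scheme : forall n, (n < nT)%N ->
    forall (psi xi w q : V -> R) (v : V -> V),
      Vh l Th psi -> Vh l Th xi -> Vh_pos l Th w -> Xh l Th v -> Vh l Th q ->
      [/\ phase_eq n psi, potential_eq n xi, energy_eq n w, momentum_eq n v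
        & pressure_eq n q]
}.

(* The dissipation of step k, i.e. with upper index k+1. *)
Definition dissipation (k : nat) : R :=
  (let f x := Num.sqrt (eta_star k x * theta^[k.+1] x) *: symgrad (um k) x in
   <<<[ f, f ]>>>)
  + (let g x := row_mx (grad mu^[k.+1] x) (grad theta^[k.+1] x) in
     <<[ g, fun x => mulmv (Lmat_star k x) (g x) ]>>).

Definition convexity_density (xi1 xi2 xi3 : V -> R) (k : nat) (x : V) : R :=
  - dsnd (dsnd (Psi M)) (phi^[k] x) (xi3 x) * dnode tau theta k x ^+ 2
  + (dfst (dfst (Psi_vex M)) (xi1 x) (theta^[k.+1] x)
     - dfst (dfst (Psi_cav M)) (xi2 x) (theta^[k.+1] x))
    * dnode tau phi k x ^+ 2.

(* The factor 1/2 in front of the second integral is the one of the Lagrange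
   remainder f(y) - f(x) - f'(x)(y - x) = f''(xi)(y - x)^2 / 2. *)
Definition numerical_dissipation (xi1 xi2 xi3 : V -> R) (k : nat) : R :=
  gam M / 2 * <<[ grad (dnode tau phi k), grad (dnode tau phi k) ]>>
  + 2^-1 * intO a l (convexity_density xi1 xi2 xi3 k)
  + tau * eps *
    (let f x := Num.sqrt (theta^[k.+1] x) * divg (um k) x in <[ f, f ]>)
  + tau * delta *
    (let f x := (h * Num.sqrt (theta^[k.+1] x)) *: grad pi^[k.+1] x in
     <<[ f, f ]>>).

Definition total_energy (n : nat) (x : V) : R :=
  2^-1 * dotv (u^[n] x) (u^[n] x) + energy_node n x.

End Scheme.

(* [xi] is a function on the torus whose values are convex combinations of
   those of [f] and [g]. *)
Definition convex_combination (R : realType) (d : nat) (l : R)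
    (f g xi : 'rV[R]_d -> R) : Prop :=
  cube_periodic l xi /\
  forall x, exists2 s : R, 0 <= s <= 1 & xi x = (1 - s) * f x + s * g x.

(* Main.v *)
Require Import Defs.
From mathcomp Require Import all_boot all_order all_algebra finmap.
From mathcomp Require Import all_classical all_reals all_analysis.
From mathcomp Require Import measurable_realfun ring lra.

(** The scheme is built so that the test functions of the continuous theory are
    admissible.  Testing the phase equation with 1 gives conservation of mass
    ([mass_step]).  Testing the energy equation with 1, the momentum equation
    with the mid-point velocity and the pressure equation with the pressure,
    and adding up, gives conservation of the total energy
    ([total_energy_step]).  Testing the phase equation with the chemical
    potential, the potential equation with the increment of [phi] and the
    energy equation with [theta] at the new time level gives the production of
    entropy ([entropy_step]).

    For the last one the increment of the entropy in a step has to be compared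
    with the tested terms.  The increment of [theta e - Psi] equals
    [theta de - (d Psi / d phi) dphi], with the convex-concave split derivative,
    up to three second order Taylor remainders ([potential_increment]).  They
    are nonnegative by concavity in [theta] and by the choice of expansion
    points in the convex and the concave part, and their Lagrange forms provide
    the functions [xi1], [xi2], [xi3] ([xi_exist]).  Likewise the increment of
    the squared gradient leaves a square ([entropy_increment]).

    The analytic part makes these manipulations legitimate: the integrands must
    be integrable, and the gradient of a difference must be the difference of
    gradients almost everywhere.  All integrands are bounded Borel functions on
    the cube (the class [tame]).  For a continuous function that agrees at each
    point of the cube with one of finitely many affine forms, a partial
    derivative can only be one of the finitely many slopes, or the default
    value of a divergent limit, and the set where a given value is attained is
    Borel ([derive_is_slope], [measurable_quotient_limit], [tame_derive]).
    Finiteness of the range also makes coefficients that depend continuously on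
    a gradient measurable and bounded ([tame_comp_finite]).  Finally, partial
    derivatives exist off finitely many hyperplanes
    ([derivable_off_hyperplanes]), which are null sets
    ([lebesgue_hyperplane]). *)

Set Implicit Arguments.
Unset Strict Implicit.
Unset Printing Implicit Defensive.

Import Order.TTheory GRing.Theory Num.Theory numFieldNormedType.Exports.

Local Open Scope classical_set_scope.
Local Open Scope ring_scope.

(** * Lebesgue measure of boxes and hyperplanes *)

Section LebesgueTupleFacts.
Context (R : realType).
Local Notation Rm := (measurableTypeR R).

Lemma measurable_linear_form (n : nat) (c : 'I_n -> R) :
  measurable_fun [set: n.-tuple Rm] (fun t => \sum_i c i * (tnth t i : R)).
Proof.
apply: measurable_sum => i; apply: measurable_funM => //.
exact: measurable_tnth.
Qed.

Lemma measurable_hyperplane (n : nat) (c : 'I_n -> R) (b : R) :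
  measurable [set t : n.-tuple Rm | \sum_i c i * (tnth t i : R) = b].
Proof.
have := @measurable_linear_form n c measurableT [set b] (measurable_set1 b).
by rewrite setTI.
Qed.

Lemma lebesgue_tupleS (n : nat) (A : set (n.+1.-tuple Rm)) :
  lebesgue_tuple R n.+1 A =
  (lebesgue_tuple R n \x @lebesgue_measure R)%E (@Defs.cons_tuple R n @^-1` A).
Proof. by []. Qed.

Lemma head_cons n (z : n.-tuple Rm * Rm) : tnth (Defs.cons_tuple z) ord0 = z.2.
Proof. exact: tnth0. Qed.

Lemma tail_cons n (z : n.-tuple Rm * Rm) i :
  tnth (Defs.cons_tuple z) (lift ord0 i) = tnth z.1 i.
Proof. exact: tnthS. Qed.

(** Induction on the dimension, integrating out the head coordinate: if its
    coefficient does not vanish, the sections in that coordinate are points;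
    otherwise the hyperplane is a cylinder over one of lower dimension. *)
Lemma lebesgue_hyperplane (n : nat) (c : 'I_n -> R) (b : R) :
  (exists i, c i != 0) ->
  lebesgue_tuple R n [set t | \sum_i c i * (tnth t i : R) = b] = 0%E.
Proof.
elim: n c b => [c b [[]]//|n IH c b cn0].
rewrite lebesgue_tupleS.
have -> : @Defs.cons_tuple R n @^-1` [set t | \sum_i c i * (tnth t i : R) = b]
    = [set z : n.-tuple Rm * Rm |
        c ord0 * z.2 + \sum_i c (lift ord0 i) * (tnth z.1 i : R) = b].
  have E z : \sum_i c i * (tnth (Defs.cons_tuple z) i : R)
      = c ord0 * z.2 + \sum_i c (lift ord0 i) * (tnth z.1 i : R).
    rewrite big_ord_recl head_cons; congr (_ + _).
    by apply: eq_bigr => i _; rewrite tail_cons.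
  by apply/seteqP; split => z /=; rewrite E.
have [c0|c0] := eqVneq (c ord0) 0.
  have -> : [set z : n.-tuple Rm * Rm |
        c ord0 * z.2 + \sum_i c (lift ord0 i) * (tnth z.1 i : R) = b]
      = [set t : n.-tuple Rm | \sum_i c (lift ord0 i) * (tnth t i : R) = b]
        `*` setT.
    by apply/seteqP; split => z /=; rewrite c0 mul0r add0r // => -[].
  rewrite product_measure1E //; last exact: measurable_hyperplane.
  rewrite IH ?mul0e //.
  have [i ci0] := cn0.
  by case: (unliftP ord0 i) ci0 => [j ->|->]; [exists j|rewrite c0 eqxx].
rewrite /product_measure1 /= integral0_eq // => t _ /=.
rewrite (_ : xsection _ t =
  [set (b - \sum_i c (lift ord0 i) * (tnth t i : R)) / c ord0]).
  by rewrite lebesgue_measure_set1.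
apply/seteqP; split => y; rewrite /xsection /= inE /=.
  by move=> <-; rewrite addrK mulrC mulKf.
by move=> ->; rewrite mulrC divfK // subrK.
Qed.

Definition tuple_box (n : nat) (lo hi : 'I_n -> R) : set (n.-tuple Rm) :=
  [set t | forall i, lo i <= (tnth t i : R) <= hi i].

Lemma measurable_box (n : nat) (lo hi : 'I_n -> R) :
  measurable (tuple_box lo hi).
Proof.
have -> : tuple_box lo hi = \bigcap_(i in [set: 'I_n])
    ((fun t : n.-tuple Rm => (tnth t i : R)) @^-1` `[lo i, hi i]).
  apply/seteqP; split => t /= H i; first by move=> _ /=; rewrite in_itv /= H.
  by have := H i I; rewrite /= in_itv.
apply: fin_bigcap_measurable => // i _.
have := @measurable_tnth _ Rm n i measurableT [set` `[lo i, hi i]]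
  (measurable_itv _).
by rewrite setTI.
Qed.

Lemma lebesgue_box_lty (n : nat) (lo hi : 'I_n -> R) :
  (lebesgue_tuple R n (tuple_box lo hi) < +oo)%E.
Proof.
elim: n lo hi => [|n IH] lo hi.
  rewrite (_ : tuple_box _ _ = setT); last by apply/seteqP; split => // t _ [].
  by rewrite /= diracT ltry.
rewrite lebesgue_tupleS.
have -> : @Defs.cons_tuple R n @^-1` tuple_box lo hi
    = tuple_box (fun i => lo (lift ord0 i)) (fun i => hi (lift ord0 i))
      `*` [set` `[lo ord0, hi ord0]].
  apply/seteqP; split => -[t y] /= H.
    split; last by rewrite /= in_itv /=; have := H ord0; rewrite head_cons.
    by move=> i; have := H (lift ord0 i); rewrite tail_cons.
  move=> i; case: (unliftP ord0 i) => [j ->|->]; rewrite ?tail_cons ?head_cons.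
    by case: H => + _; apply.
  by case: H => _; rewrite in_itv.
rewrite product_measure1E //; last exact: measurable_box.
rewrite lte_mul_pinfty //; first by rewrite ge0_fin_numE.
rewrite [X in (X < _)%E](@lebesgue_measure_itv R) /=; case: ifP => _;
  last exact: ltry.
by rewrite -EFinB ltry.
Qed.

End LebesgueTupleFacts.

(** * Algebra of vectors and matrices *)

Section VectorAlgebra.
Context (R : realType) (d : nat).
Local Notation V := 'rV[R]_d.

Lemma dotvC n (x y : 'rV[R]_n) : dotv x y = dotv y x.
Proof. by apply: eq_bigr => i _; rewrite mulrC. Qed.

Lemma dotvZl n k (x y : 'rV[R]_n) : dotv (k *: x) y = k * dotv x y.
Proof. by rewrite /dotv mulr_sumr; apply: eq_bigr => i _;
  rewrite mxE mulrA. Qed.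

Lemma dotvZr n k (x y : 'rV[R]_n) : dotv x (k *: y) = k * dotv x y.
Proof. by rewrite dotvC dotvZl dotvC. Qed.

Lemma dotv_basis (i : 'I_d) (x : V) : dotv (Defs.basis R i) x = x 0 i.
Proof.
rewrite /dotv (bigD1 i) //= big1 ?addr0 => [|j /negPf ji].
  by rewrite mxE !eqxx mul1r.
by rewrite mxE eqxx ji mul0r.
Qed.

Lemma dotvBl (x y z : V) : dotv (x - y) z = dotv x z - dotv y z.
Proof.
by rewrite /dotv -sumrB; apply: eq_bigr => i _; rewrite !mxE mulrBl.
Qed.

Lemma dotv_line (c : V) (i : 'I_d) (t : R) (x : V) :
  dotv c (t *: Defs.basis R i + x) = t * c 0 i + dotv c x.
Proof.
rewrite /dotv (eq_bigr (fun j => t * (c 0 j * (j == i)%:R) + c 0 j * x 0 j)).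
  rewrite big_split /= -mulr_sumr; congr (_ * _ + _).
  rewrite (bigD1 i) //= eqxx mulr1 big1 ?addr0 // => j /negPf ->.
  by rewrite mulr0.
by move=> j _; rewrite !mxE eqxx /= mulrDr mulrCA.
Qed.

Lemma dotvBr (x y z : V) : dotv x (y - z) = dotv x y - dotv x z.
Proof. by rewrite dotvC dotvBl !(dotvC x). Qed.

Lemma dotvDl (x y z : V) : dotv (x + y) z = dotv x z + dotv y z.
Proof.
by rewrite /dotv -big_split; apply: eq_bigr => i _; rewrite mxE mulrDl.
Qed.

Lemma dotv0r (x : V) : dotv x 0 = 0.
Proof. by rewrite /dotv big1 // => i _; rewrite mxE mulr0. Qed.

Lemma dotv_ge0 n (x : 'rV[R]_n) : 0 <= dotv x x.
Proof. by apply: sumr_ge0 => i _; rewrite -expr2 sqr_ge0. Qed.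

Lemma dotmZl k (A B : 'M[R]_d) : dotm (k *: A) B = k * dotm A B.
Proof.
rewrite /dotm mulr_sumr; apply: eq_bigr => i _; rewrite mulr_sumr.
by apply: eq_bigr => j _; rewrite mxE mulrA.
Qed.

Lemma dotmZr k (A B : 'M[R]_d) : dotm A (k *: B) = k * dotm A B.
Proof.
rewrite /dotm mulr_sumr; apply: eq_bigr => i _; rewrite mulr_sumr.
by apply: eq_bigr => j _; rewrite mxE mulrCA.
Qed.

Lemma dotv_outer k (g x y : V) :
  dotv (mulmv (k *: outer g g) x) y = k * (dotv g x * dotv g y).
Proof.
rewrite /mulmv -scalemxAl linearZ /= dotvZl; congr (_ * _).
rewrite -dotvZl; congr (dotv _ y).
apply/rowP => i; rewrite /outer !mxE.
rewrite [RHS]mulrC /dotv mulr_sumr.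
by apply: eq_bigr => j _; rewrite !mxE big_ord1 !mxE mulrA.
Qed.

Lemma dotv_row_mx (x x' y y' : V) :
  dotv (row_mx x y) (row_mx x' y') = dotv x x' + dotv y y'.
Proof.
rewrite /dotv big_split_ord /=; congr (_ + _); apply: eq_bigr => i _.
  by rewrite !row_mxEl.
by rewrite !row_mxEr.
Qed.

Lemma mulmv_block (A B C D : 'M[R]_d) (x y : V) :
  mulmv (block_mx A B C D) (row_mx x y)
  = row_mx (mulmv A x + mulmv B y) (mulmv C x + mulmv D y).
Proof. by rewrite /mulmv tr_row_mx mul_block_col tr_col_mx !linearD. Qed.

Lemma mulNmv (A : 'M[R]_d) (x : V) : mulmv (- A) x = - mulmv A x.
Proof. by rewrite /mulmv mulNmx linearN. Qed.

Lemma dotv_Lmat (M : model R d) p g t (x y : V) :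
  dotv (row_mx x y) (mulmv (Lmat M p g t) (row_mx x y)) =
  dotv (mulmv (L11 M p g t) x - mulmv (L12 M p g t) y) x
  - dotv (mulmv (L12 M p g t) x - mulmv (L22 M p g t) y) y.
Proof.
rewrite mulmv_block dotv_row_mx !mulNmv !(dotvC _ x) !(dotvC _ y).
by rewrite [_ + mulmv (L22 _ _ _ _) _]addrC !dotvBr; ring.
Qed.

End VectorAlgebra.

(** * Bounded Borel functions on the cube *)

Section Tame.
Context (R : realType) (d : nat) (a : 'rV[R]_d) (l : R).
Local Notation Rm := (measurableTypeR R).
Local Notation V := 'rV[R]_d.

Lemma tuple_rowE (t : d.-tuple Rm) i : tuple_row t 0 i = tnth t i.
Proof. by rewrite mxE. Qed.

(** The measurable sets of tuples are generated by the coordinates, the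
    topology of row vectors by cubes; an open set is the union of the
    countably many rational cubes that it contains. *)
Lemma measurable_preimage_row (U : set V) :
  open U -> measurable (@tuple_row R d @^-1` U).
Proof.
move=> oU.
pose lo (q : 'rV[rat]_d * nat) (i : 'I_d) : R :=
  ratr (q.1 0 i) - q.2.+1%:R^-1.
pose hi (q : 'rV[rat]_d * nat) (i : 'I_d) : R :=
  ratr (q.1 0 i) + q.2.+1%:R^-1.
pose B q : set (d.-tuple Rm) :=
  if pselect (tuple_box (lo q) (hi q) `<=` @tuple_row R d @^-1` U)
  then tuple_box (lo q) (hi q) else set0.
have -> : @tuple_row R d @^-1` U = \bigcup_q B q.
  apply/seteqP; split => t; last first.
    by move=> [q _]; rewrite /B; case: pselect => // h /h.
  move=> Ut; have /nbhs_ballP[e /= e0 eU] : nbhs (tuple_row t) U.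
    exact: open_nbhs_nbhs.
  have [n [r [rE r0 re]]] : exists (n : nat) (r : R),
      [/\ r = n.+1%:R^-1, 0 < r & r < e / 2].
    have [n _ /(_ n (leqnn n)) ne] :=
      near_infty_natSinv_lt (PosNum (divr_gt0 e0 (ltr0n _ 2))).
    by exists n, n.+1%:R^-1; split; rewrite ?invr_gt0 ?ltr0n.
  have /choice[q hq] : forall i : 'I_d, exists q : rat,
      tuple_row t 0 i - r < ratr q < tuple_row t 0 i + r.
    move=> i; have [|q] := @rat_in_itvoo R (tuple_row t 0 i - r)
      (tuple_row t 0 i + r); first by lra.
    by rewrite in_itv => hq; exists q.
  exists (\row_i q i, n) => //; rewrite /B; case: pselect => [_ i|[]].
    rewrite /lo /hi /= mxE -rE -tuple_rowE; have /andP[h1 h2] := hq i.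
    by apply/andP; split; lra.
  move=> s hs; apply: eU; split => // i j; rewrite /ball /= ord1.
  have /andP[h1 h2] := hq j; have := hs j.
  rewrite /lo /hi /= mxE -rE -tuple_rowE => /andP[h3 h4].
  rewrite ltr_norml; apply/andP; split; lra.
apply: (@countable_bigcupT_measurable _ _ _ B) => [|q]; first exact: countableP.
by rewrite /B; case: pselect => ?; [exact: measurable_box|exact: measurable0].
Qed.

Lemma measurable_continuous_row (f : V -> R) :
  continuous f -> measurable_fun setT (f \o @tuple_row R d).
Proof.
move=> /continuousP cf; apply: (measurability _ (RGenOpens.measurableE R)).
move=> _ [_ [b [c ->] <-]]; rewrite setTI comp_preimage.
by apply: measurable_preimage_row; apply: cf; exact: interval_open.
Qed.

Lemma Omega_box :
  Omega a l = tuple_box (fun i => a 0 i) (fun i => a 0 i + l).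
Proof.
by apply/seteqP; split => t h i; have := h i; rewrite tuple_rowE.
Qed.

Lemma measurable_Omega : measurable (Omega a l).
Proof. by rewrite Omega_box; exact: measurable_box. Qed.

Lemma lebesgue_Omega_lty : (lebesgue_tuple R d (Omega a l) < +oo)%E.
Proof. by rewrite Omega_box; exact: lebesgue_box_lty. Qed.

Lemma compact_cube : compact (cube a l).
Proof.
have -> : cube a l =
    [set v : V | forall i, [set` `[a 0 i, a 0 i + l]] (v ord0 i)].
  by apply/seteqP; split => v h i; have := h i; rewrite /= in_itv.
apply: (@rV_compact R d (fun i => [set` `[a 0 i, a 0 i + l]])) => i.
exact: segment_compact.
Qed.

(** The class in which all integrands of the scheme live.  Gradients are
    classical derivatives with some value even on the mesh skeleton, so
    measurability is required everywhere and not up to a null set. *)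
Definition tame (f : V -> R) : Prop :=
  measurable_fun (Omega a l) (f \o @tuple_row R d) /\
  exists C, forall x, cube a l x -> `|f x| <= C.

Lemma tame_integrable (f : V -> R) : tame f -> integrableO a l f.
Proof.
move=> [mf [C fC]]; apply: measurable_bounded_integrable => //.
- exact: measurable_Omega.
- exact: lebesgue_Omega_lty.
- by exists C; split => [|M CM t /fC/le_trans]; [exact: num_real|apply;
  exact: ltW].
Qed.

Lemma tame_ext (f g : V -> R) :
  (forall x, cube a l x -> f x = g x) -> tame f -> tame g.
Proof.
move=> fg [mf [C fC]]; split; last by exists C => x hx; rewrite -fg // fC.
apply: eq_measurable_fun mf => t /[!inE] ht; exact: fg.
Qed.

Lemma tame_cst (c : R) : tame (fun=> c).
Proof. by split; [exact: measurable_cst|exists `|c|]. Qed.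

Lemma tameD (f g : V -> R) : tame f -> tame g -> tame (fun x => f x + g x).
Proof.
move=> [mf [C fC]] [mg [D gD]]; split.
  exact: (measurable_realfun.measurable_funD mf mg).
by exists (C + D) => x hx; rewrite (le_trans (ler_normD _ _)) // lerD ?fC ?gD.
Qed.

Lemma tameM (f g : V -> R) : tame f -> tame g -> tame (fun x => f x * g x).
Proof.
move=> [mf [C fC]] [mg [D gD]]; split.
  exact: (measurable_realfun.measurable_funM mf mg).
by exists (C * D) => x hx; rewrite normrM ler_pM ?fC ?gD.
Qed.

Lemma tameN (f : V -> R) : tame f -> tame (fun x => - f x).
Proof.
by move=> /(tameM (tame_cst (-1))); apply: tame_ext => x _; rewrite mulN1r.
Qed.

Lemma tameB (f g : V -> R) : tame f -> tame g -> tame (fun x => f x - g x).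
Proof. by move=> tf /tameN; exact: tameD. Qed.

Lemma tame_sum (I : Type) (r : seq I) (f : I -> V -> R) :
  (forall i, tame (f i)) -> tame (fun x => \sum_(i <- r) f i x).
Proof.
move=> tf; elim: r => [|i r IH].
  by apply: tame_ext (tame_cst 0) => x _; rewrite big_nil.
by apply: tame_ext (tameD (tf i) IH) => x _; rewrite big_cons.
Qed.

Lemma tame_prod (I : Type) (r : seq I) (f : I -> V -> R) :
  (forall i, tame (f i)) -> tame (fun x => \prod_(i <- r) f i x).
Proof.
move=> tf; elim: r => [|i r IH].
  by apply: tame_ext (tame_cst 1) => x _; rewrite big_nil.
by apply: tame_ext (tameM (tf i) IH) => x _; rewrite big_cons.
Qed.

Lemma tame_indic (S : set V) :
  measurable (@tuple_row R d @^-1` S) -> tame (\1_S).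
Proof.
move=> mS; split; last first.
  by exists 1 => x _; rewrite indicE; case: (_ \in _); rewrite ?normr1 ?normr0.
exact: (measurable_indic mS).
Qed.

Lemma tame_eq (f : V -> R) (c : R) : tame f -> tame (fun x => (f x == c)%:R).
Proof.
move=> [mf _]; split; last first.
  by exists 1 => x _; case: (_ == _); rewrite ?normr1 ?normr0.
have m1 : measurable_fun [set: R] (\1_[set c] : R -> R).
  by apply: measurable_indic; exact: measurable_set1.
have := measurableT_comp m1 mf; apply: eq_measurable_fun => t _ /=.
by rewrite indicE; congr (nat_of_bool _)%:R; apply/idP/eqP; rewrite inE.
Qed.

Lemma tame_continuous (f : V -> R) : continuous f -> tame f.
Proof.
move=> cf; split.
  apply: measurable_funS (measurable_continuous_row cf) => //.
have := compact_bounded (continuous_compact (continuous_subspaceT cf)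
  compact_cube).
move=> [M [_ /(_ (M + 1))]] H; exists (M + 1) => x hx.
by apply: H; [rewrite ltrDl|exists x].
Qed.

Lemma intO_ext (f g : V -> R) :
  (forall x, cube a l x -> f x = g x) -> intO a l f = intO a l g.
Proof. by move=> fg; apply: eq_Rintegral => t /[!inE] /fg. Qed.

Lemma intOD (f g : V -> R) : tame f -> tame g ->
  intO a l (fun x => f x + g x) = intO a l f + intO a l g.
Proof.
move=> tf tg; apply: RintegralD; [exact: measurable_Omega|..];
  exact: tame_integrable.
Qed.

Lemma intOZ (c : R) (f : V -> R) : tame f ->
  intO a l (fun x => c * f x) = c * intO a l f.
Proof.
move=> tf; apply: RintegralZl; [exact: measurable_Omega|..];
  exact: tame_integrable.
Qed.

Lemma intON (f : V -> R) : tame f ->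
  intO a l (fun x => - f x) = - intO a l f.
Proof.
by move=> tf; rewrite -mulN1r -intOZ //; apply: intO_ext => x _; rewrite mulN1r.
Qed.

Lemma intOB (f g : V -> R) : tame f -> tame g ->
  intO a l (fun x => f x - g x) = intO a l f - intO a l g.
Proof. by move=> tf tg; rewrite intOD ?intON //; exact: tameN. Qed.

Lemma intO_ge0 (f : V -> R) :
  (forall x, cube a l x -> 0 <= f x) -> 0 <= intO a l f.
Proof. by move=> f0; apply: Rintegral_ge0 => t; exact: f0. Qed.

Lemma intO_eq0 (f : V -> R) :
  (forall x, cube a l x -> f x = 0) -> intO a l f = 0.
Proof.
move=> f0; rewrite (@intO_ext _ (fun=> 0 * 0)) => [|x /f0 ->];
  last by rewrite mul0r.
by rewrite intOZ ?mul0r //; exact: tame_cst.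
Qed.

Lemma intO_ae (f g : V -> R) (N : set (d.-tuple Rm)) :
  tame f -> tame g -> measurable N -> lebesgue_tuple R d N = 0%E ->
  (forall t, Omega a l t -> ~ N t -> f (tuple_row t) = g (tuple_row t)) ->
  intO a l f = intO a l g.
Proof.
move=> [mf _] [mg _] mN N0 fg; congr fine; apply: ae_eq_integral.
- exact: measurable_Omega.
- exact/measurable_EFinP.
- exact/measurable_EFinP.
exists N; split => // t /=; apply: contra_notP => nNt Ot.
by rewrite fg.
Qed.

End Tame.

(** * Partial derivatives of piecewise affine functions *)

Section PiecewiseAffine.
Context (R : realType) (d : nat) (a : 'rV[R]_d) (l : R).
Local Notation Rm := (measurableTypeR R).
Local Notation V := 'rV[R]_d.
Hypothesis l_gt0 : 0 < l.

Lemma near_all_in (I : eqType) (T : Type) (F : set_system T) (s : seq I)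
    (P : I -> T -> Prop) : Filter F ->
  (forall i, i \in s -> \forall t \near F, P i t) ->
  \forall t \near F, forall i, i \in s -> P i t.
Proof.
move=> FF; elim: s => [|i s IH] H; first exact: nearW.
have Hi := H i (mem_head i s).
have Hs : \forall t \near F, forall j, j \in s -> P j t.
  by apply: IH => j js; apply: H; rewrite inE js orbT.
apply: filterS2 Hi Hs => t Pi Ps j.
by rewrite inE => /orP[/eqP->|/Ps].
Qed.

Lemma near_dnbhs0P (P : R -> Prop) :
  (\forall t \near (0 : R)^', P t) <->
  exists2 e, 0 < e & forall t, t != 0 -> `|t| < e -> P t.
Proof.
split=> [/nbhs_ballP[e /= e0 h]|[e e0 h]].
  by exists e => // t t0 te; apply: h => //; rewrite /ball /= sub0r normrN.
apply/nbhs_ballP; exists e => //= t; rewrite /ball /= sub0r normrN => te t0.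
exact: h.
Qed.

Lemma dotv_continuous (c : V) : continuous (dotv c).
Proof.
rewrite /dotv; apply: (continuous_big (@add_continuous R^o)) => i _ x.
apply: (@cvgM R V (nbhs x) _ (fun=> c 0 i) (fun x => x 0 i)).
  exact: cvg_cst.
exact: coord_continuous.
Qed.

Lemma line_continuous (i : 'I_d) (x : V) :
  continuous (fun t : R => t *: Defs.basis R i + x).
Proof.
move=> t; apply: cvgD; last exact: cvg_cst.
by apply: cvgZr_tmp; exact: cvg_id.
Qed.

(** A function piecewise affine on the cube agrees at every point with one
    of finitely many affine forms, coded by gradient and constant term. *)
Definition touches (v : V -> R) (x : V) (p : V * R) : Prop :=
  v x = dotv p.1 x + p.2.

Variables (v : V -> R) (s : seq (V * R)).
Hypothesis v_cont : continuous v.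
Hypothesis v_pieces : forall x, cube a l x -> exists2 p,
  p \in s & touches v x p.

Local Notation quot x i t := (t^-1 *: (v (t *: Defs.basis R i + x) - v x) : R).

(** The points touching a given piece form a closed set: a piece met by points
    arbitrarily close to [x] touches [x], and its slope is then the difference
    quotient. *)
Lemma near_touches (i : 'I_d) (x : V) :
  \forall t \near (0 : R)^', forall p, p \in s ->
    touches v (t *: Defs.basis R i + x) p -> touches v x p /\ quot x i t = p.1
      0 i.
Proof.
apply: near_all_in => p _.
have H : \forall t \near (0 : R)^',
    touches v (t *: Defs.basis R i + x) p -> touches v x p.
  have [tp|ntp] := pselect (touches v x p); first exact: nearW.
  pose g y := v y - (dotv p.1 y + p.2).
  have gcont : continuous g.
    move=> y; apply: (@cvgB _ R V (nbhs y) _ v); first exact: v_cont.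
    by apply: cvgD; [exact: dotv_continuous|exact: cvg_cst].
  have gc : continuous (fun t : R => g (t *: Defs.basis R i + x)).
    move=> t; apply: (@continuous_comp _ _ _ (fun t : R =>
      t *: Defs.basis R i + x) g).
      exact: line_continuous.
    exact: gcont.
  have g0 : g (0 *: Defs.basis R i + x) != 0.
    by rewrite scale0r add0r subr_eq0; apply/eqP.
  have Hg : \forall t \near (0 : R)^', g (t *: Defs.basis R i + x) != 0.
    exact: nbhs_dnbhs (cvgr_neq0 _ (gc 0) g0).
  by apply: filterS Hg => t; rewrite subr_eq0 => /eqP.
have Hn : \forall t \near (0 : R)^', t != 0 by exact: nbhs_dnbhs_neq.
apply: filterS2 H Hn => t H t0 tp; have tx := H tp.
split => //; rewrite tp tx dotv_line.
rewrite (_ : _ - _ = t * p.1 0 i); last by ring.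
by rewrite /GRing.scale /= mulKf.
Qed.

(** From a point of the cube one can move by a small nonzero step along each
    coordinate axis without leaving it, in at least one direction. *)
Lemma cube_line (i : 'I_d) (x : V) (e : R) : cube a l x -> 0 < e ->
  exists t, [/\ t != 0, `|t| < e & cube a l (t *: Defs.basis R i + x)].
Proof.
move=> cx e0.
pose r := Num.min (e / 2) (l / 2).
have [r0 re rl] : [/\ 0 < r, r < e & r <= l / 2].
  by rewrite /r lt_min gt_min ge_min lexx !divr_gt0 //= orbT; split => //; lra.
have coord t j : (t *: Defs.basis R i + x) 0 j = (if j == i then t else 0) + x
  0 j.
  by rewrite !mxE eqxx /=; case: (j == i); rewrite ?mulr1 ?mulr0.
have [xi|xi] := leP (x 0 i) (a 0 i + l / 2).
  exists r; split; rewrite ?gt_eqF ?gtr0_norm // => j; rewrite coord.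
  have /andP[h1 h2] := cx j; case: eqP => [ji|_]; last by rewrite add0r cx.
  by rewrite -ji in xi; apply/andP; split; lra.
exists (- r); split; rewrite ?oppr_eq0 ?gt_eqF ?normrN ?gtr0_norm // => j.
rewrite coord; have /andP[h1 h2] := cx j.
case: eqP => [ji|_]; last by rewrite add0r cx.
by rewrite -ji in xi; apply/andP; split; lra.
Qed.

(** Where a partial derivative exists, the difference quotients along the
    points that stay in the cube are eventually slopes of pieces touching the
    base point; as there are finitely many slopes, so is the limit. *)
Lemma derive_is_slope (i : 'I_d) (x : V) : cube a l x ->
  derivable v x (Defs.basis R i) ->
  'D_(Defs.basis R i) v x \in [seq (p : V * R).1 0 i | p <- s].
Proof.
move=> cx dx; apply/negPn/negP => nD.
have H1 : \forall t \near (0 : R)^', forall f,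
  f \in [seq (p : V * R).1 0 i | p <- s] ->
    quot x i t != f.
  apply: near_all_in => f fs.
  have Df : 'D_(Defs.basis R i) v x - f != 0.
    by rewrite subr_eq0; apply: contraNneq nD => ->.
  have cq : (quot x i t - f) @[t --> (0 : R)^'] --> 'D_(Defs.basis R i) v x - f.
    by apply: cvgB; [exact: dx|exact: cvg_cst].
  by apply: filterS (cvgr_neq0 _ cq Df) => t; rewrite subr_eq0.
have [e e0 he] := (near_dnbhs0P _).1 (filterI H1 (near_touches i x)).
have [t [t0 te ct]] := cube_line i cx e0.
have [h1 h2] := he _ t0 te.
have [p ps tp] := v_pieces ct.
have [_ /eqP] := h2 p ps tp.
by apply/negP; apply: h1; exact: map_f.
Qed.

Definition quotient_limit (i : 'I_d) (c : R) : set V :=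
  [set x | quot x i t @[t --> (0 : R)^'] --> c].

(** By continuity of [v] the points where the quotients stay close to [c] for
    all small steps form a closed set, so that [quotient_limit] is a countable
    intersection of countable unions of closed sets. *)
Lemma measurable_quotient_limit (i : 'I_d) (c : R) :
  measurable (@tuple_row R d @^-1` quotient_limit i c).
Proof.
pose C (k n : nat) : set V := \bigcap_(t in [set t : R | t != 0 /\ `|t| <
  n.+1%:R^-1])
  [set x | `|c - quot x i t| <= k.+1%:R^-1].
have -> : @tuple_row R d @^-1` quotient_limit i c
    = \bigcap_k \bigcup_n (@tuple_row R d @^-1` C k n).
  apply/seteqP; split => y.
    move=> /= /cvgrPdist_le H k _.
    have k0 : (0 : R) < k.+1%:R^-1 by rewrite invr_gt0 ltr0n.
    have /near_dnbhs0P[e e0 he] := H _ k0.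
    have [n _ /(_ n (leqnn n)) ne] := near_infty_natSinv_lt (PosNum e0).
    exists n => // t [t0 tn]; apply: he => //; exact: lt_trans tn ne.
  move=> H /=; apply/cvgrPdist_le => e e0.
  have [k _ /(_ k (leqnn k)) ke] := near_infty_natSinv_lt (PosNum e0).
  have [n _ hn] := H k I.
  apply/near_dnbhs0P; exists n.+1%:R^-1; first by rewrite invr_gt0 ltr0n.
  move=> t t0 tn; apply: le_trans (ltW ke); exact: hn.
apply: bigcap_measurableType => k _; apply: bigcupT_measurable => n.
rewrite -[X in measurable X]setCK; apply: measurableC.
apply: (@measurable_preimage_row R d (~` C k n)); apply: closed_openC.
apply: closed_bigI => t _.
have sc : continuous (fun x : V => v (t *: Defs.basis R i + x)).
  move=> x; apply: (@continuous_comp _ _ _ (fun x : V =>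
    t *: Defs.basis R i + x) v).
    apply: (@cvgD R V V (nbhs x) _ (fun=> t *: Defs.basis R i) id).
      exact: cvg_cst.
    exact: cvg_id.
  exact: v_cont.
have qc : continuous (fun x => quot x i t).
  move=> x; apply: (@cvgM R V (nbhs x) _ (fun=> t^-1)
    (fun x => v (t *: Defs.basis R i + x) - v x)); first exact: cvg_cst.
  by apply: (@cvgB _ R V (nbhs x) _ _ v); [exact: sc|exact: v_cont].
apply: (@preimage_closed _ _ (fun x =>
  `|c - quot x i t|) [set y | y <= k.+1%:R^-1]);
  last exact: closed_le.
move=> x _; apply: (@cvg_norm R R^o V (nbhs x) _ (fun x => c - quot x i t)).
by apply: (@cvgB _ R V (nbhs x) _ (fun=> c)); [exact: cvg_cst|exact: qc].
Qed.

Lemma derive_finite (i : 'I_d) : exists F : seq R, forall x, cube a l x ->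
  'D_(Defs.basis R i) v x \in F.
Proof.
exists (point :: [seq (p : V * R).1 0 i | p <- s]) => x cx.
have [dx|ndx] := pselect (derivable v x (Defs.basis R i)).
  by rewrite inE derive_is_slope ?orbT.
by rewrite inE /derive dvgP ?eqxx.
Qed.

(** On the cube the partial derivative is a combination of indicators of the
    sets [quotient_limit i f], [f] ranging over the slopes; where it does not
    exist it takes the default value [point]. *)
Lemma tame_derive (i : 'I_d) : tame a l ('D_(Defs.basis R i) v).
Proof.
pose F := undup [seq (p : V * R).1 0 i | p <- s].
pose g x := point + \sum_(f <- F) (f - point) * \1_(quotient_limit i f) x : R.
apply: (@tame_ext _ _ _ _ g); last first.
  apply: tameD; first exact: tame_cst.
  apply: tame_sum => f; apply: tameM; first exact: tame_cst.
  by apply: tame_indic; exact: measurable_quotient_limit.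
move=> x cx; rewrite /g.
have [dx|ndx] := pselect (derivable v x (Defs.basis R i)); last first.
  rewrite big1 ?addr0 => [|f _]; first by rewrite /derive dvgP.
  rewrite indicE memNset ?mulr0 // => H; apply: ndx.
  by apply/cvg_ex; exists f.
have Dq : quotient_limit i ('D_(Defs.basis R i) v x) x by exact: dx.
rewrite (bigD1_seq ('D_(Defs.basis R i) v x)) ?undup_uniq //=; last first.
  by rewrite mem_undup derive_is_slope.
rewrite indicE mem_set // mulr1 big1 ?addr0 => [|f fD];
  first by rewrite addrC subrK.
rewrite indicE memNset ?mulr0 // => H; move/eqP: fD; apply.
exact: (cvg_unique _ H Dq).
Qed.

(** Off the faces of the cube and off the hyperplanes where two pieces with
    different gradients agree, all pieces touching the point have the same
    slope, and the difference quotients are locally constant. *)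
Lemma derivable_off_hyperplanes :
  exists2 hs : seq (V * R), forall p, p \in hs -> p.1 != 0 &
    forall x, cube a l x -> (forall p, p \in hs -> dotv p.1 x <> p.2) ->
    forall i, derivable v x (Defs.basis R i).
Proof.
pose faces := flatten [seq [:: (Defs.basis R i, a 0 i);
                             (Defs.basis R i, a 0 i + l)] | i <- enum 'I_d].
pose crossings := [seq (p.1 - q.1, q.2 - p.2) | p : V * R <- s, q : V * R <- s].
exists (faces ++ [seq q <- crossings | q.1 != 0]).
  move=> p; rewrite mem_cat => /orP[/flatten_mapP[i _]|].
    have b0 : Defs.basis R i != 0.
      apply/eqP => /matrixP /(_ 0 i); rewrite !mxE !eqxx => /eqP.
      by rewrite oner_eq0.
    by rewrite !inE => /orP[] /eqP ->.
  by rewrite mem_filter => /andP[].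
move=> x cx off i.
have strict : a 0 i < x 0 i < a 0 i + l.
  have /andP[h1 h2] := cx i.
  have H b : b \in [:: a 0 i; a 0 i + l] -> x 0 i != b.
    move=> hb; apply/eqP; rewrite -dotv_basis.
    apply: (off (Defs.basis R i, b)); rewrite mem_cat; apply/orP; left.
    apply/flatten_mapP; exists i; first by rewrite mem_enum.
    by move: hb; rewrite !inE => /orP[] /eqP ->; rewrite eqxx ?orbT.
  rewrite lt_neqAle h1 lt_neqAle h2 !andbT [a 0 i == _]eq_sym.
  by rewrite !H ?inE ?eqxx ?orbT.
have same p q : p \in s -> q \in s -> touches v x p -> touches v x q ->
    p.1 0 i = q.1 0 i.
  move=> ps qs tp tq.
  have [->//|pq] := eqVneq p.1 q.1.
  exfalso; apply: (off (p.1 - q.1, q.2 - p.2)).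
    rewrite mem_cat mem_filter subr_eq0 pq /=; apply/orP; right.
    by apply/allpairsP; exists (p, q).
  by rewrite dotvBl /=; move: tp tq; rewrite /touches => -> /eqP;
    rewrite -subr_eq0 => /eqP tq; apply/eqP; rewrite -subr_eq0 -tq; apply/eqP;
      ring.
have [p0 ps0 tp0] := v_pieces cx.
apply/cvg_ex; exists (p0.1 0 i); apply: cvg_near_cst.
have e0 : 0 < Num.min (x 0 i - a 0 i) (a 0 i + l - x 0 i).
  by case/andP: strict => h1 h2; rewrite lt_min !subr_gt0 h1 h2.
have [e1 e10 he1] := (near_dnbhs0P _).1 (near_touches i x).
apply/near_dnbhs0P; exists (Num.min e1 (Num.min (x 0 i - a 0 i)
    (a 0 i + l - x 0 i))); first by rewrite lt_min e10 e0.
move=> t t0; rewrite lt_min => /andP[/(he1 t t0) ht te].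
have ct : cube a l (t *: Defs.basis R i + x).
  move=> j; have := cx j; rewrite !mxE eqxx /=.
  case: eqP => [->|_]; rewrite ?mulr1 ?mulr0 ?add0r // => _.
  move: te; rewrite lt_min !ltr_norml => /andP[/andP[h1 h2] /andP[h3 h4]].
  by apply/andP; split; lra.
have [p ps tp] := v_pieces ct.
have [tx qx] := ht p ps tp.
by rewrite -(same p p0).
Qed.

End PiecewiseAffine.

Section Null.
Context (R : realType) (d : nat).
Local Notation Rm := (measurableTypeR R).
Local Notation V := 'rV[R]_d.

Lemma hyperplanes_null (hs : seq (V * R)) :
  (forall p, p \in hs -> p.1 != 0) ->
  exists N : set (d.-tuple Rm),
    [/\ measurable N, lebesgue_tuple R d N = 0%E &
      forall p t, p \in hs -> dotv p.1 (tuple_row t) = p.2 -> N t].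
Proof.
elim: hs => [_|p hs IH h0]; first by exists set0; split => //; rewrite measure0.
have [|N [mN N0 hN]] := IH; first by move=> q qs; apply: h0;
  rewrite inE qs orbT.
pose H := [set t : d.-tuple Rm | \sum_i p.1 0 i * (tnth t i : R) = p.2].
have mH : measurable H by exact: measurable_hyperplane.
exists (H `|` N); split; first exact: measurableU.
  rewrite measureU0 //; apply: lebesgue_hyperplane; apply: contrapT => nE.
  have /negP[] := h0 p (mem_head _ _); apply/eqP/rowP => i; rewrite mxE.
  by apply: contrapT => /eqP pi; apply: nE; exists i.
move=> q t; rewrite inE => /orP[/eqP-> e|qs e]; [left|right; exact: hN e].
by rewrite /H /= -e; apply: eq_bigr => i _; rewrite tuple_rowE.
Qed.

End Null.

(** * Second order Taylor formula and tangents *)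

Section Taylor.
Context (R : realType).

(** Rolle's theorem for [h s = g 1 - g s - g1 s (1 - s) - K (1 - s)^2], with
    [K] such that [h 0 = h 1 = 0]; its derivative is
    [(1 - s) (2 K - g2 s)]. *)
Lemma taylor_lagrange01 (g g1 g2 : R -> R) :
  (forall s : R, 0 <= s <= 1 -> is_derive s 1 g (g1 s)) ->
  (forall s : R, 0 <= s <= 1 -> is_derive s 1 g1 (g2 s)) ->
  exists2 s : R, 0 <= s <= 1 & g 1 - g 0 - g1 0 = g2 s / 2.
Proof.
move=> dg dg1; pose K := g 1 - g 0 - g1 0.
pose h s := g 1 - g s - g1 s * (1 - s) - K * (1 - s) ^+ 2.
have dh (s : R) : 0 <= s <= 1 -> is_derive s 1 h ((1 - s) * (2 * K - g2 s)).
  move=> hs; have H := dg s hs; have H1 := dg1 s hs.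
  have E : h = (cst (g 1) - g - g1 * (cst 1 - id) - K *: (cst 1 - id) ^+ 2).
    by apply/funext => r.
  rewrite E; apply: is_derive_eq.
  by rewrite /GRing.scale /= !fctE /=; ring.
have [c hc [_ ]] : exists2 c : R, c \in `]0, 1[ & is_derive c 1 h 0.
  apply: Rolle; first exact: ltr01.
  - move=> s; rewrite in_itv /= => /andP[s0 s1].
    by apply: (@ex_derive _ _ _ _ _ _ _ (dh s _)); rewrite !ltW.
  - apply: derivable_within_continuous => s; rewrite in_itv /= => hs.
    exact: (@ex_derive _ _ _ _ _ _ _ (dh s hs)).
  - by rewrite /h /K; ring.
move: hc; rewrite in_itv /= => /andP[c0 c1] hc0.
have hc : 0 <= c <= 1 by rewrite !ltW.
exists c => //.
have [_ hd] := dh c hc; move: hd; rewrite hc0 => /esym/eqP.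
rewrite mulf_eq0 subr_eq0 eq_sym lt_eqF //= subr_eq0 => /eqP <-.
by rewrite mulrC mulKf.
Qed.

(** The difference quotients of [g] at 0 dominate the slope of the chord. *)
Lemma tangent_ge01 (g : R -> R) (dg : R) :
  (forall t : R, 0 < t < 1 -> (1 - t) * g 0 + t * g 1 <= g t) ->
  is_derive (0 : R) 1 g dg -> g 1 - g 0 <= dg.
Proof.
move=> cg [d0 <-]; rewrite leNgt; apply/negP => lt.
have eps0 : 0 < g 1 - g 0 - 'D_1 g 0 by rewrite subr_gt0.
have /cvgrPdist_lt /(_ _ eps0) /near_dnbhs0P[e e0 he] : (fun h : R =>
  h^-1 *: ((g \o shift 0) (h *: 1) - g 0)) @ 0^' --> 'D_1 g 0 by exact: d0.
pose t := Num.min (e / 2) (1 / 2).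
have [t0 te t1] : [/\ 0 < t, t < e & t <= 1 / 2].
  by rewrite /t lt_min gt_min ge_min lexx !divr_gt0 //= orbT; split => //; lra.
have := he t; rewrite gt_eqF // gtr0_norm // => /(_ isT te).
rewrite /= /GRing.scale /= mulr1 addr0 ltr_norml => /andP[h1 h2].
have := cg t; rewrite t0 /= => /(_ (le_lt_trans t1 _)) ct.
have {ct} : t * (g 1 - g 0) <= g t - g 0 by have := ct ltac:(lra); lra.
by rewrite -ler_pdivlMl // => ct; lra.
Qed.

Lemma is_derive_segment (f f1 : R -> R) (x y : R) (s : R) :
  is_derive (x + s * (y - x)) 1 f (f1 (x + s * (y - x))) ->
  is_derive s 1 (fun r => f (x + r * (y - x))) (f1 (x + s * (y - x)) * (y - x)).
Proof.
move=> H.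
have H2 : is_derive s 1 (fun r : R => x + r * (y - x)) (y - x).
  have -> : (fun r : R => x + r * (y - x)) = (cst x + (y - x) *: id).
    by apply/funext => r; rewrite !fctE /GRing.scale /= mulrC.
  by apply: is_derive_eq; rewrite add0r /GRing.scale /= mulr1.
have := is_derive1_comp (f := f) (g := fun r : R => x + r * (y - x)).
by move=> /(_ _ _ _ H H2).
Qed.

Lemma taylor_lagrange (f f1 f2 : R -> R) (x y : R) :
  (forall s : R, 0 <= s <= 1 -> is_derive (x + s * (y - x)) 1 f (f1 (x + s *
    (y - x)))) ->
  (forall s : R, 0 <= s <= 1 -> is_derive (x + s * (y - x)) 1 f1 (f2 (x + s *
    (y - x)))) ->
  exists2 s : R, 0 <= s <= 1 &
    f y - f x - f1 x * (y - x) = f2 (x + s * (y - x)) / 2 * (y - x) ^+ 2.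
Proof.
move=> H1 H2.
have D1 (s : R) (hs : 0 <= s <= 1) := is_derive_segment (H1 s hs).
have D2 (s : R) : 0 <= s <= 1 ->
    is_derive s 1 (fun r : R => f1 (x + r * (y - x)) * (y - x))
      (f2 (x + s * (y - x)) * (y - x) * (y - x)).
  move=> hs; have H := is_derive_segment (H2 s hs).
  have -> : (fun r : R => f1 (x + r * (y - x)) * (y - x))
     = (y - x) *: (fun r : R => f1 (x + r * (y - x))).
    by apply/funext => r; rewrite !fctE /GRing.scale /= mulrC.
  by apply: is_derive_eq; rewrite /GRing.scale /= mulrC.
have [s hs E] := taylor_lagrange01 D1 D2.
exists s => //; move: E.
have -> : x + 1 * (y - x) = y by ring.
have -> : x + 0 * (y - x) = x by ring.
by move=> ->; field.
Qed.

Lemma concave_tangent (f : R -> R) (df x y : R) :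
  (forall t : R, 0 < t < 1 -> (1 - t) * f x + t * f y <= f (x + t * (y - x))) ->
  is_derive x 1 f df -> f y <= f x + df * (y - x).
Proof.
move=> cf H.
have H0 : is_derive (x + 0 * (y - x)) 1 f ((fun=> df) (x + 0 * (y - x))).
  by rewrite mul0r addr0.
have e1 : x + 1 * (y - x) = y by ring.
have e0 : x + 0 * (y - x) = x by ring.
rewrite addrC -lerBlDr.
have := tangent_ge01 _ (is_derive_segment H0); rewrite e1 e0; exact.
Qed.

End Taylor.

(** * Thermodynamic potential *)

Section Model.
Context (R : realType) (d : nat) (M : model R d).
Hypothesis hM : model_assumptions M.

Lemma is_derive_dsnd (F : R -> R -> R) (p t : R) :
  C1_pos F -> 0 < t -> is_derive t 1 (F p) (dsnd F p t).
Proof.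
move=> cF t0; have [_ h _ _ _] := cF p t t0.
by rewrite /dsnd derive1E; exact: DeriveDef.
Qed.

Lemma is_derive_dfst (F : R -> R -> R) (p t : R) :
  C1_pos F -> 0 < t -> is_derive p 1 (F ^~ t) (dfst F p t).
Proof.
move=> cF t0; have [h _ _ _ _] := cF p t t0.
by rewrite /dfst derive1E; exact: DeriveDef.
Qed.

Definition theta_remainder (p t0 t1 : R) : R :=
  Psi M p t0 + dsnd (Psi M) p t0 * (t1 - t0) - Psi M p t1.
Definition vex_remainder (p0 p1 t : R) : R :=
  Psi_vex M p0 t - Psi_vex M p1 t + dfst (Psi_vex M) p1 t * (p1 - p0).
Definition cav_remainder (p0 p1 t : R) : R :=
  Psi_cav M p0 t + dfst (Psi_cav M) p0 t * (p1 - p0) - Psi_cav M p1 t.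

Lemma theta_remainder_lagrange (p t0 t1 : R) : 0 < t0 -> 0 < t1 ->
  exists2 s, 0 <= s <= 1 & theta_remainder p t0 t1 =
    - dsnd (dsnd (Psi M)) p ((1 - s) * t0 + s * t1) * (t1 - t0) ^+ 2 / 2.
Proof.
move=> t00 t10; have [C1 _ C2] := Psi_C2 hM.
have pos (s : R) : 0 <= s <= 1 -> 0 < t0 + s * (t1 - t0).
  by move=> /andP[s0 s1]; have [->|s1'] := eqVneq s 1; nra.
have [s hs E] := taylor_lagrange
  (fun s hs => is_derive_dsnd p C1 (pos s hs))
  (fun s hs => is_derive_dsnd p C2 (pos s hs)).
exists s => //; rewrite /theta_remainder.
have -> : (1 - s) * t0 + s * t1 = t0 + s * (t1 - t0) by ring.
by move: E; set X := dsnd _ _ (_ + _ * _); lra.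
Qed.

Lemma vex_remainder_lagrange (p0 p1 t : R) : 0 < t ->
  exists2 s, 0 <= s <= 1 & vex_remainder p0 p1 t =
    dfst (dfst (Psi_vex M)) ((1 - s) * p0 + s * p1) t * (p1 - p0) ^+ 2 / 2.
Proof.
move=> t0; have [C1 C2 _] := Psi_vex_C2 hM.
have [s hs E] := @taylor_lagrange _ (Psi_vex M ^~ t) (dfst (Psi_vex M) ^~ t)
  (dfst (dfst (Psi_vex M)) ^~ t) p1 p0
  (fun s _ => is_derive_dfst _ C1 t0) (fun s _ => is_derive_dfst _ C2 t0).
exists (1 - s); first by lra.
rewrite /vex_remainder.
have -> : (1 - (1 - s)) * p0 + (1 - s) * p1 = p1 + s * (p0 - p1) by ring.
by move: E; set X := dfst (dfst _) _ _; lra.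
Qed.

Lemma cav_remainder_lagrange (p0 p1 t : R) : 0 < t ->
  exists2 s, 0 <= s <= 1 & cav_remainder p0 p1 t =
    - dfst (dfst (Psi_cav M)) ((1 - s) * p0 + s * p1) t * (p1 - p0) ^+ 2 / 2.
Proof.
move=> t0; have [C1 C2 _] := Psi_cav_C2 hM.
have [s hs E] := @taylor_lagrange _ (Psi_cav M ^~ t) (dfst (Psi_cav M) ^~ t)
  (dfst (dfst (Psi_cav M)) ^~ t) p0 p1
  (fun s _ => is_derive_dfst _ C1 t0) (fun s _ => is_derive_dfst _ C2 t0).
exists s => //; rewrite /cav_remainder.
have -> : (1 - s) * p0 + s * p1 = p0 + s * (p1 - p0) by ring.
by move: E; set X := dfst (dfst _) _ _; lra.
Qed.

Lemma theta_remainder_ge0 (p t0 t1 : R) : 0 < t0 -> 0 < t1 ->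
  0 <= theta_remainder p t0 t1.
Proof.
move=> t00 t10; have [C1 _ _] := Psi_C2 hM.
rewrite /theta_remainder subr_ge0.
apply: concave_tangent (is_derive_dsnd p C1 t00) => t /andP[h0 h1].
have ht : 0 <= t <= 1 by rewrite !ltW.
have := Psi_concave hM p t10 t00 ht.
by congr (_ <= _); [rewrite addrC|congr (Psi M p _); ring].
Qed.

Lemma strictly_convex_segment (f : R -> R) (p q t : R) :
  strictly_convex f -> 0 < t < 1 ->
  f (p + t * (q - p)) <= (1 - t) * f p + t * f q.
Proof.
move=> cf ht; have [->|pq] := eqVneq p q.
  by rewrite subrr mulr0 addr0 -mulrDl subrK mul1r.
have ht' : 0 < 1 - t < 1 by lra.
have := cf p q (1 - t) pq ht'; rewrite subKr => /ltW.
by congr (f _ <= _); ring.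
Qed.

Lemma vex_remainder_ge0 (p0 p1 t : R) : 0 < t -> 0 <= vex_remainder p0 p1 t.
Proof.
move=> t0; have [C1 _ _] := Psi_vex_C2 hM.
have H := is_deriveN (is_derive_dfst p1 C1 t0).
have := @concave_tangent _ _ _ p1 p0 _ H; rewrite !fctE.
rewrite /vex_remainder => C; suff: - Psi_vex M p0 t <=
    - Psi_vex M p1 t + - dfst (Psi_vex M) p1 t * (p0 - p1) by lra.
apply: C => s hs.
have := strictly_convex_segment p1 p0 (Psi_vex_convex hM t0) hs.
by lra.
Qed.

Lemma cav_remainder_ge0 (p0 p1 t : R) : 0 < t -> 0 <= cav_remainder p0 p1 t.
Proof.
move=> t0; have [C1 _ _] := Psi_cav_C2 hM.
rewrite /cav_remainder subr_ge0.
apply: (@concave_tangent _ (Psi_cav M ^~ t)); last exact: is_derive_dfst.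
move=> s hs.
have := strictly_convex_segment p0 p1 (Psi_cav_concave hM t0) hs.
by lra.
Qed.

(** The increment of [t Psi_t - Psi] is expanded along the path
    (p0, t0), (p0, t1), (p1, t1); along the second leg the convex part is
    expanded at the new value and the concave part at the old one, so that
    both remainders are nonnegative. *)
Lemma potential_increment (p0 p1 t0 t1 : R) : 0 < t1 ->
  (t1 * dsnd (Psi M) p1 t1 - Psi M p1 t1)
    - (t0 * dsnd (Psi M) p0 t0 - Psi M p0 t0)
  = t1 * (dsnd (Psi M) p1 t1 - dsnd (Psi M) p0 t0)
    - dphi_split M p1 p0 t1 * (p1 - p0)
    + (theta_remainder p0 t0 t1 + vex_remainder p0 p1 t1
       + cav_remainder p0 p1 t1).
Proof.
move=> t10; rewrite /theta_remainder /vex_remainder /cav_remainder /dphi_split.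
by rewrite !(Psi_split hM _ t10); ring.
Qed.

End Model.

(** * Finite element functions and coefficients *)

Section FiniteElements.
Context (R : realType) (d : nat) (a : 'rV[R]_d) (l : R).
Local Notation V := 'rV[R]_d.
Context (Th : {fset {fset V}}).
Hypothesis l_gt0 : 0 < l.
Hypothesis hTh : periodic_conforming_mesh a l Th.

Lemma Vh_cst (c : R) : Vh l Th (fun=> c).
Proof.
split; [exact: cst_continuous|by []|].
move=> K _; exists 0, c => x _.
by rewrite /dotv big1 ?add0r // => i _; rewrite mxE mul0r.
Qed.

Lemma Vh_lin (k m : R) (v w : V -> R) :
  Vh l Th v -> Vh l Th w -> Vh l Th (fun x => k * v x + m * w x).
Proof.
move=> [cv pv av] [cw pw aw]; split.
- move=> x; apply: (@cvgD R R^o V (nbhs x) _ (fun x => k * v x) (fun x =>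
  m * w x)).
    by apply: (@cvgM R V (nbhs x) _ (fun=> k) v); [exact: cvg_cst|exact: cv].
  by apply: (@cvgM R V (nbhs x) _ (fun=> m) w); [exact: cvg_cst|exact: cw].
- by move=> i x /=; rewrite pv pw.
- move=> K KT; have [c [b Hc]] := av K KT; have [c' [b' Hc']] := aw K KT.
  exists (k *: c + m *: c'), (k * b + m * b') => x xK.
  rewrite (Hc x xK) (Hc' x xK).
  have -> : dotv (k *: c + m *: c') x = k * dotv c x + m * dotv c' x.
    rewrite /dotv !mulr_sumr -big_split /=; apply: eq_bigr => i _.
    by rewrite !mxE; ring.
  by ring.
Qed.

Lemma Vh_pieces (v : V -> R) : Vh l Th v ->
  exists s : seq (V * R),
    forall x, cube a l x -> exists2 p, p \in s & touches v x p.
Proof.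
move=> [_ _ av]; have [_ cover _] := hTh.
have /choice[c hc] : forall K : {fset V}, exists c : V * R,
    K \in Th -> forall x, hull K x -> touches v x c.
  move=> K; have [KT|] := boolP (K \in Th); last by exists (0, 0).
  by have [c [b H]] := av K KT; exists (c, b).
exists [seq c K | K <- Th] => x; rewrite cover => -[K KT Kx].
by exists (c K); [exact: map_f|exact: hc].
Qed.

Lemma Vh_tame (v : V -> R) : Vh l Th v -> tame a l v.
Proof. by case=> cv _ _; exact: tame_continuous. Qed.

Definition tamev (f : V -> V) : Prop := forall i, tame a l (fun x => f x 0 i).
Definition tamem (f : V -> 'M[R]_d) : Prop :=
  forall i j, tame a l (fun x => f x i j).

Lemma tamev_grad (v : V -> R) : Vh l Th v -> tamev (grad v).
Proof.
move=> hv i; have [s hs] := Vh_pieces hv; have [cv _ _] := hv.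
by apply: tame_ext (tame_derive l_gt0 cv hs i) => x _; rewrite mxE.
Qed.

Lemma grad_finite (v : V -> R) (i : 'I_d) : Vh l Th v ->
  exists F : seq R, forall x, cube a l x -> grad v x 0 i \in F.
Proof.
move=> hv; have [s hs] := Vh_pieces hv; have [cv _ _] := hv.
have [F hF] := derive_finite l_gt0 cv hs i.
by exists F => x /hF; rewrite mxE.
Qed.

Lemma tame_dotv (f g : V -> V) : tamev f -> tamev g ->
  tame a l (fun x => dotv (f x) (g x)).
Proof. by move=> tf tg; apply: tame_sum => i; exact: tameM. Qed.

Lemma tamevZ (k : V -> R) (f : V -> V) : tame a l k -> tamev f ->
  tamev (fun x => k x *: f x).
Proof.
by move=> tk tf i; apply: tame_ext (tameM tk (tf i)) => x _; rewrite mxE.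
Qed.

Lemma tamevB (f g : V -> V) : tamev f -> tamev g ->
  tamev (fun x => f x - g x).
Proof.
by move=> tf tg i; apply: tame_ext (tameB (tf i) (tg i)) => x _; rewrite !mxE.
Qed.

Lemma tamev_mulmv (A : V -> 'M[R]_d) (f : V -> V) : tamem A -> tamev f ->
  tamev (fun x => mulmv (A x) (f x)).
Proof.
move=> tA tf i; apply: (@tame_ext _ _ _ _ (fun x => \sum_j A x i j * f x 0 j)).
  by move=> x _; rewrite !mxE; apply: eq_bigr => j _; rewrite mxE.
by apply: tame_sum => j; exact: tameM.
Qed.

(** A gradient takes finitely many values, so composing with it amounts to
    gluing finitely many tame functions along tame indicators. *)
Lemma tame_comp_finite (g : V -> V) (H : V -> V -> R) :
  tamev g ->
  (forall i, exists F : seq R, forall x, cube a l x -> g x 0 i \in F) ->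
  (forall y, tame a l (H y)) -> tame a l (fun x => H (g x) x).
Proof.
move=> tg /choice[F hF] tH.
pose F0 := flatten [seq F i | i <- enum 'I_d].
pose val (k : {ffun 'I_d -> 'I_(size F0)}) : V := \row_i F0`_(k i).
pose G := undup [seq val k | k <- enum {: {ffun 'I_d -> 'I_(size F0)}}].
apply: (@tame_ext _ _ _ _ (fun x => \sum_(y <- G)
   (\prod_(i <- enum 'I_d) (g x 0 i == y 0 i)%:R) * H y x)); last first.
  apply: tame_sum => y; apply: tameM => //; apply: tame_prod => i.
  by apply: tame_eq; exact: tg.
move=> x cx.
have gG : g x \in G.
  rewrite mem_undup.
  have mF i : g x 0 i \in F0.
    by apply/flatten_mapP; exists i; [rewrite mem_enum|exact: hF].
  have iF i : (index (g x 0%R i) F0 < size F0)%N by rewrite index_mem.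
  apply/mapP; exists [ffun i => Ordinal (iF i)]; first by rewrite mem_enum.
  by apply/rowP => i; rewrite mxE ffunE /= nth_index.
rewrite (bigD1_seq (g x)) ?undup_uniq //= big1_seq => [|i _];
  last by rewrite eqxx.
rewrite mul1r big1 ?addr0 // => y yg.
have [i gi] : exists i, g x 0 i != y 0 i.
  apply: contrapT => nE; move/eqP: yg; apply; apply/rowP => i.
  by apply/eqP; apply/negPn/negP => /eqP/nesym/eqP h; apply: nE; exists i.
rewrite (bigD1_seq i) ?mem_enum ?enum_uniq //=.
by rewrite (negPf gi) !mul0r.
Qed.

Lemma grad_sub_ae (v w : V -> R) : Vh l Th v -> Vh l Th w ->
  exists N : set (d.-tuple (measurableTypeR R)),
    [/\ measurable N, lebesgue_tuple R d N = 0%E &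
      forall t, Omega a l t -> ~ N t ->
        grad (fun x => v x - w x) (tuple_row t)
        = grad v (tuple_row t) - grad w (tuple_row t)].
Proof.
move=> hv hw; have [s hs] := Vh_pieces hv; have [s' hs'] := Vh_pieces hw.
have [cv _ _] := hv; have [cw _ _] := hw.
have [H1 n1 d1] := derivable_off_hyperplanes cv hs.
have [H2 n2 d2] := derivable_off_hyperplanes cw hs'.
have [|N [mN N0 hN]] := @hyperplanes_null R d (H1 ++ H2).
  by move=> p; rewrite mem_cat => /orP[/n1|/n2].
exists N; split => // t Ot Nt.
have offs p : p \in H1 ++ H2 -> dotv p.1 (tuple_row t) <> p.2.
  by move=> pH e; apply: Nt; exact: hN pH e.
apply/rowP => i; rewrite !mxE; apply: deriveB.
  by apply: d1 => // p pH; apply: offs; rewrite mem_cat pH.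
by apply: d2 => // p pH; apply: offs; rewrite mem_cat pH orbT.
Qed.

Lemma continuous_comp2 (F : R -> R -> R) (phi theta : V -> R) :
  (forall p t, 0 < t -> {for (p, t), continuous (fun z : R * R =>
    F z.1 z.2)}) ->
  continuous phi -> continuous theta -> (forall x, 0 < theta x) ->
  continuous (fun x => F (phi x) (theta x)).
Proof.
move=> cF cp ct t0 x.
apply: (@continuous_comp _ _ _ (fun x => (phi x, theta x))
  (fun z : R * R => F z.1 z.2)); last exact: cF.
exact: (cvg_pair (cp x) (ct x)).
Qed.

End FiniteElements.

Section Coefficients.
Context (R : realType) (d : nat) (M : model R d).
Hypothesis hM : model_assumptions M.
Context (a : 'rV[R]_d) (l : R) (Th : {fset {fset 'rV[R]_d}}).
Local Notation V := 'rV[R]_d.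
Hypothesis l_gt0 : 0 < l.
Hypothesis hTh : periodic_conforming_mesh a l Th.
Context (phi theta : V -> R).
Hypotheses (hphi : Vh l Th phi) (htheta : Vh_pos l Th theta).

Lemma tame_comp2 (F : R -> R -> R) :
  (forall p t, 0 < t -> {for (p, t), continuous (fun z : R * R =>
    F z.1 z.2)}) ->
  tame a l (fun x => F (phi x) (theta x)).
Proof.
move=> cF; have [cp _ _] := hphi; have [[ct _ _] t0] := htheta.
exact: tame_continuous (continuous_comp2 cF cp ct t0).
Qed.

Lemma C1_pos_continuous (F : R -> R -> R) (p t : R) : C1_pos F -> 0 < t ->
  {for (p, t), continuous (fun z : R * R => F z.1 z.2)}.
Proof. by move=> cF t0; have [_ _ h _ _] := cF p t t0. Qed.

Lemma tame_invtheta : tame a l (fun x => (theta x)^-1).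
Proof.
apply: (tame_comp2 (F := fun _ t => t^-1)) => p t t0.
apply: (@cvgV R (R * R)%type (nbhs (p, t)) _ (fun z => z.2));
  first by rewrite gt_eqF.
exact: cvg_snd.
Qed.

Lemma tame_energy : tame a l (energy M phi theta).
Proof.
apply: (tame_comp2 (F := dsnd (Psi M))) => p t t0.
by have [_ _ C] := Psi_C2 hM; exact: C1_pos_continuous C t0.
Qed.

Lemma tame_entropy : tame a l (entropy M phi theta).
Proof.
have tg := tamev_grad l_gt0 hTh hphi.
apply: tameB; last by apply: tameM; [exact: tame_cst|exact: tame_dotv].
apply: tameB.
  by apply: tameM tame_energy; apply: Vh_tame; exact: htheta.1.
apply: (tame_comp2 (F := Psi M)) => p t t0.
by have [C _ _] := Psi_C2 hM; exact: C1_pos_continuous C t0.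
Qed.

Lemma tamem_korteweg : tamem a l (korteweg M phi theta).
Proof.
have tg := tamev_grad l_gt0 hTh hphi; move=> i j.
apply: (@tame_ext _ _ _ _ (fun x =>
  gam M * (theta x)^-1 * (grad phi x 0 i * grad phi x 0 j))).
  by move=> x _; rewrite /korteweg /outer !mxE big_ord1 !mxE.
apply: tameM; last exact: tameM.
by apply: tameM; [exact: tame_cst|exact: tame_invtheta].
Qed.

(** With the gradient frozen at one of its values, the entries of [Lmat] are
    continuous functions of the position. *)
Lemma tame_Lmat (i j : 'I_(d + d)) :
  tame a l (fun x => Lmat M (phi x) (grad phi x) (theta x) i j).
Proof.
apply: (tame_comp_finite (H := fun g x => Lmat M (phi x) g (theta x) i j)).
- exact: (tamev_grad l_gt0 hTh hphi).
- by move=> k; exact: (grad_finite l_gt0 hTh k hphi).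
move=> g; apply: (tame_comp2 (F := fun p t => Lmat M p g t i j)) => p t tp.
apply: (@continuous_comp _ _ _ (fun z : R * R => Lmat M z.1 g z.2)
  (fun A : 'M[R]_(d + d) => A i j)); last exact: coord_continuous.
apply: (@continuous_comp _ _ _ (fun z : R * R => (z.1, g, z.2))
  (fun z : R * V * R => Lmat M z.1.1 z.1.2 z.2)); last exact: (Lmat_cont hM).
apply: (@cvg_pair _ _ _ (nbhs (p, t)) (nbhs (p, g)) (nbhs t)
  _ _ _ (fun z : R * R => (z.1, g)) (fun z => z.2)); last exact: cvg_snd.
apply: (@cvg_pair _ _ _ (nbhs (p, t)) (nbhs p) (nbhs g)
  _ _ _ (fun z : R * R => z.1) (fun=> g)); [exact: cvg_fst|exact: cvg_cst].
Qed.

Lemma tamem_L11 : tamem a l (fun x => L11 M (phi x) (grad phi x) (theta x)).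
Proof.
move=> i j; apply: tame_ext (tame_Lmat (lshift d i) (lshift d j)) => x _.
by rewrite /Lmat block_mxEul.
Qed.

Lemma tamem_L12 : tamem a l (fun x => L12 M (phi x) (grad phi x) (theta x)).
Proof.
move=> i j.
apply: tame_ext (tameN (tame_Lmat (lshift d i) (rshift d j))) => x _.
by rewrite /Lmat block_mxEur mxE opprK.
Qed.

Lemma tamem_L22 : tamem a l (fun x => L22 M (phi x) (grad phi x) (theta x)).
Proof.
move=> i j; apply: tame_ext (tame_Lmat (rshift d i) (rshift d j)) => x _.
by rewrite /Lmat block_mxEdr.
Qed.

End Coefficients.

(** * One time step *)

Section StepAlgebra.
Context (R : realType).

(** The shapes of the energy and momentum equations, for evaluating these term
    by term once a test function is fixed. *)
Lemma eq_energy_terms (e k x1 x2 x3 x4 x5 x6 x7 x8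
    y1 y2 y3 y4 y5 y6 y7 y8 : R) :
  y1 + y2 - y3 - e * y4 - k * y5 - y6 - y7 - y8 = 0 ->
  y1 = x1 -> y2 = x2 -> y3 = x3 -> y4 = x4 -> y5 = x5 -> y6 = x6 ->
  y7 = x7 -> y8 = x8 ->
  x1 + x2 - x3 - e * x4 - k * x5 - x6 - x7 - x8 = 0.
Proof. by move=> E <- <- <- <- <- <- <- <-. Qed.

Lemma eq_momentum_terms (e x1 x2 x3 x4 x5 x6 y1 y2 y3 y4 y5 y6 : R) :
  y1 + y2 + y3 + e * y4 - y5 + y6 = 0 ->
  y1 = x1 -> y2 = x2 -> y3 = x3 -> y4 = x4 -> y5 = x5 -> y6 = x6 ->
  x1 + x2 + x3 + e * x4 - x5 + x6 = 0.
Proof. by move=> E <- <- <- <- <- <-. Qed.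

Lemma eq_of_scaled_sub (t x y : R) : 0 < t -> t^-1 * (x - y) = 0 -> x = y.
Proof.
move=> t0 /eqP; rewrite mulf_eq0 invr_eq0 gt_eqF //= subr_eq0.
by move/eqP.
Qed.

Lemma sqrt_mul_self (x : R) : 0 <= x -> Num.sqrt x * Num.sqrt x = x.
Proof. by move=> x0; rewrite -[LHS]expr2 sqr_sqrtr. Qed.

(** [S], [Q]: increments of energy and phase tested with inverse temperature
    and chemical potential; [C], [J], [K]: transport, heat flux and phase flux;
    [vis], [div], [pr]: the dissipative terms; [W], [X]: gradient and potential
    parts of the chemical potential equation; [Y], [r]: remainders. *)
Lemma entropy_balance (t e k S Q C J K vis div pr W X Y r : R) :
  S = t * (vis + e * div + k * pr + C - J) -> Q = t * (C - K) ->
  Q - W - X = 0 ->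
  S - X - W + Y + r
  = t * (vis + (K - J)) + (Y + r + t * e * div + t * k * pr).
Proof. by move=> -> -> H; lra. Qed.

Lemma half_sum (A B C x y : R) :
  - A * x + (B - C) * y = 2 * (- A * x / 2 + B * y / 2 + - C * y / 2).
Proof. by field. Qed.

End StepAlgebra.

Section Scheme.
Context (R : realType) (d : nat) (M : model R d).
Hypothesis hM : model_assumptions M.
Local Notation V := 'rV[R]_d.
Context (a : V) (l : R) (hl : 0 < l) (Th : {fset {fset V}}).
Hypothesis hTh : periodic_conforming_mesh a l Th.
Context (eps delta : R).
Context (tau : R) (nT : nat) (htau : 0 < tau) (ts : nat -> R).
Hypothesis hts : forall n, (n < nT)%N -> n%:R * tau <= ts n <= n.+1%:R * tau.
Context (phi mu theta pi : R -> V -> R) (u : R -> V -> V).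
Context (phi0 theta0 : V -> R) (u0 : V -> V).
Hypothesis hsol : discrete_solution M a l Th eps delta tau nT ts
  phi mu theta pi u phi0 theta0 u0.

Local Notation "g ^[ n ]" := (node tau g n)
  (at level 2, n at level 50, format "g ^[ n ]").
Local Notation um := (midnode tau u).
Local Notation tame := (tame a l).
Local Notation tamev := (tamev a l).
Local Notation tamem := (tamem a l).
Local Notation h := (mesh_size Th).

Lemma node_time n : (n <= nT)%N -> 0 <= n%:R * tau <= nT%:R * tau.
Proof.
move=> nn; apply/andP; split; first by rewrite mulr_ge0 ?ler0n // ltW.
by rewrite ler_pM2r // ler_nat.
Qed.

Lemma star_time n : (n < nT)%N -> 0 <= ts n <= nT%:R * tau.
Proof.
move=> nn; have /andP[h1 h2] := hts nn.
have /andP[h3 _] := node_time (ltnW nn); have /andP[_ h4] := node_time nn.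
by rewrite (le_trans h3 h1) (le_trans h2 h4).
Qed.

Lemma phi_node n : (n <= nT)%N -> Vh l Th phi^[n].
Proof. by move=> /node_time; exact: (phi_Pi1c hsol).1. Qed.
Lemma theta_node n : (n <= nT)%N -> Vh_pos l Th theta^[n].
Proof. by move=> /node_time; exact: (theta_Pi1c hsol).1. Qed.
Lemma u_node n : (n <= nT)%N -> Xh l Th u^[n].
Proof. by move=> /node_time; exact: (u_Pi1c hsol).1. Qed.
Lemma mu_node n : (n < nT)%N -> Vh l Th mu^[n.+1].
Proof. by move=> /(mu_Pi0 hsol)[]. Qed.
Lemma pi_node n : (n < nT)%N -> Vh l Th pi^[n.+1].
Proof. by move=> /(pi_Pi0 hsol)[]. Qed.

Lemma phi_star n : (n < nT)%N -> Vh l Th (phi (ts n)).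
Proof. by move=> /star_time; exact: (phi_Pi1c hsol).1. Qed.
Lemma theta_star n : (n < nT)%N -> Vh_pos l Th (theta (ts n)).
Proof. by move=> /star_time; exact: (theta_Pi1c hsol).1. Qed.

(** At [t^* = t^n] the piecewise constant [mu] takes its value from the
   previous step, or the initial value if [n = 0]. *)
Lemma mu_star n : (n < nT)%N -> Vh l Th (mu (ts n)).
Proof.
move=> nn; have /andP[h1 h2] := hts nn.
have [e|ne] := eqVneq (ts n) (n%:R * tau).
  rewrite e; case: n nn {h1 h2 e} => [_|n nn]; first exact: (mu_init hsol).
  by have [] := mu_Pi0 hsol (ltnW nn).
have [hm ->] := mu_Pi0 hsol nn; first exact: hm.
by rewrite lt_neqAle eq_sym ne h1.
Qed.

Lemma Vh_sub (v w : V -> R) : Vh l Th v -> Vh l Th w ->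
  Vh l Th (fun x => v x - w x).
Proof.
move=> hv hw; have := Vh_lin 1 (-1) hv hw.
by congr (Vh _ _ _); apply/funext => x; rewrite mul1r mulN1r.
Qed.

Lemma dphi_Vh n : (n < nT)%N -> Vh l Th (dnode tau phi n).
Proof.
by move=> nn; apply: Vh_sub; [exact: phi_node|exact: phi_node (ltnW nn)].
Qed.

Lemma um_Xh n : (n < nT)%N -> Xh l Th (um n).
Proof.
move=> nn i; have := Vh_lin 2^-1 2^-1 (u_node nn i) (u_node (ltnW nn) i).
by congr (Vh _ _ _); apply/funext => x; rewrite /midnode !mxE mulrDr.
Qed.

Lemma Xh_tame (v : V -> V) : Xh l Th v -> tamev v.
Proof. by move=> hv i; exact: Vh_tame (hv i). Qed.

Let tgrad v := @tamev_grad R d a l Th hl hTh v.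

Lemma tame_s_phimu n : (n < nT)%N -> tame (s_phimu_star M ts phi mu theta n).
Proof.
move=> nn; apply: tameD.
  exact: (tame_entropy hM hl hTh (phi_star nn) (theta_star nn)).
by apply: tameM; [exact: Vh_tame (phi_star nn)|exact: Vh_tame (mu_star nn)].
Qed.

Lemma tamem_sigma n : (n < nT)%N -> tamem (sigma_star M ts phi theta n).
Proof. by move=> nn; exact: (tamem_korteweg M hl hTh (phi_star nn) (theta_star
  nn)). Qed.

Lemma tamev_capillary n : (n < nT)%N ->
  tamev (capillary_force M tau ts phi mu theta n).
Proof.
move=> nn; have t1 := tame_invtheta a (phi_node nn) (theta_node nn).
apply: tamevB; apply: tamevZ => //.
- by apply: tameM => //; exact: Vh_tame (phi_star nn).
- exact: tgrad (mu_node nn).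
- by apply: tamev_mulmv; [exact: tamem_sigma|exact: tgrad (theta_node nn).1].
Qed.

Lemma tame_energy_node n : (n <= nT)%N -> tame (energy_node M tau phi theta n).
Proof. by move=> nn; exact: (tame_energy hM a (phi_node nn) (theta_node nn)).
  Qed.

Lemma tame_entropy_node n : (n <= nT)%N -> tame (entropy_node M tau phi theta
  n).
Proof.
by move=> nn; exact: (tame_entropy hM hl hTh (phi_node nn) (theta_node nn)).
Qed.

Lemma tame_total_energy n : (n <= nT)%N ->
  tame (total_energy M tau phi theta u n).
Proof.
move=> nn; apply: tameD; last exact: tame_energy_node.
apply: tameM; first exact: tame_cst.
by apply: tame_dotv; exact: Xh_tame (u_node nn).
Qed.

Lemma grad_cst (c : R) x : grad (fun=> c) x = 0 :> V.
Proof. by apply/rowP => i; rewrite !mxE; exact: derive_cst. Qed.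

(** The phase equation tested with the constant 1. *)
Lemma mass_step n : (n < nT)%N -> intO a l phi^[n.+1] = intO a l phi^[n].
Proof.
move=> nn.
have [+ _ _ _ _] := scheme hsol nn (Vh_cst l Th 1) (Vh_cst l Th 1)
  (theta_node nn) (um_Xh nn) (pi_node nn).
rewrite /phase_eq /ips /ipv.
rewrite (@intO_ext _ _ _ _ _ (fun x => tau^-1 * (phi^[n.+1] x - phi^[n] x)));
  last by move=> x _; rewrite mulr1.
rewrite [X in _ - X]intO_eq0 => [|x _]; last by rewrite grad_cst dotv0r.
rewrite [X in _ + X]intO_eq0 => [|x _]; last by rewrite grad_cst dotv0r.
have t1 := Vh_tame a (phi_node nn); have t0 := Vh_tame a (phi_node (ltnW nn)).
rewrite subr0 addr0 (intOZ _ (tameB t1 t0)) (intOB t1 t0).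
exact: eq_of_scaled_sub htau.
Qed.

Section Step.
Variables (n : nat) (nn : (n < nT)%N).

Local Notation ph := (phi (ts n)).
Local Notation th := (theta (ts n)).
Local Notation sig := (sigma_star M ts phi theta n).
Local Notation sps := (s_phimu_star M ts phi mu theta n).
Local Notation cap := (capillary_force M tau ts phi mu theta n).
Local Notation eta_ := (eta_star M ts phi theta n).

Let theta1_gt0 x : 0 < theta^[n.+1] x.
Proof. exact: (theta_node nn).2. Qed.

Let t_theta1 : tame theta^[n.+1] := Vh_tame a (theta_node nn).1.
Let t_um : tamev (um n) := Xh_tame (um_Xh nn).
Let t_gtheta : tamev (grad theta^[n.+1]) := tgrad (theta_node nn).1.
Let t_gmu : tamev (grad mu^[n.+1]) := tgrad (mu_node nn).
Let t_cap : tamev cap := tamev_capillary nn.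
Let t_sth : tame (fun x => sps x / th x ^+ 2).
Proof.
apply: tameM; first exact: tame_s_phimu.
have ti := tame_invtheta a (phi_star nn) (theta_star nn).
by apply: tame_ext (tameM ti ti) => x _; rewrite -exprVn expr2.
Qed.

(** The energy equation tested with 1, the momentum equation with the mid-point
    velocity and the pressure equation with the pressure add up to the claim:
    viscous, stabilisation, capillary and entropy-flux terms cancel in pairs,
    and the convective term vanishes because it is skew. *)
Lemma total_energy_step :
  intO a l (total_energy M tau phi theta u n.+1)
  = intO a l (total_energy M tau phi theta u n).
Proof.
have V1 := Vh_cst l Th 1.
have P1 : Vh_pos l Th (fun=> 1 : R) by split.
have [_ _ E Mo P] := scheme hsol nn V1 V1 P1 (um_Xh nn) (pi_node nn).
pose T1 := intO a l (fun x => tau^-1 *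
  (energy_node M tau phi theta n.+1 x - energy_node M tau phi theta n x)).
pose Dd := ipm a l (fun x => eta_ x *: symgrad (um n) x) (symgrad (um n)).
pose Dv := ips a l (divg (um n)) (divg (um n)).
pose Pr := ipv a l (fun x => h ^+ 2 *: grad pi^[n.+1] x) (grad pi^[n.+1]).
pose Ca := ipv a l cap (um n).
pose Ft := ipv a l (fun x => (sps x / th x ^+ 2) *: grad theta^[n.+1] x) (um n).
pose Ki := ipv a l (fun x => tau^-1 *: dnode tau u n x) (um n).
pose PD := ips a l (divg (um n)) pi^[n.+1].
have E' : T1 + 0 - Dd - eps * Dv - delta * Pr - 0 - Ca - - Ft = 0.
  apply: (eq_energy_terms E); rewrite /T1 /Dd /Dv /Pr /Ca /Ft /ips /ipv /ipm.
  - by apply: intO_ext => x _; rewrite mulr1.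
  - by rewrite intO_eq0 // => x _; rewrite grad_cst dotv0r.
  - by apply: intO_ext => x _; rewrite mulr1 dotmZl.
  - by apply: intO_ext => x _; rewrite mulr1 expr2.
  - by apply: intO_ext => x _; rewrite mulr1 dotvZl.
  - by rewrite intO_eq0 // => x _; rewrite grad_cst dotv0r.
  - by apply: intO_ext => x _; rewrite scale1r.
  - rewrite -intON; last by apply: tame_dotv => //; exact: tamevZ.
    apply: intO_ext => x _; rewrite grad_cst scaler0 scale1r sub0r.
    rewrite dotvZl dotvZl dotvZr -scaleN1r dotvZr [dotv (um n x) _]dotvC.
    by ring.
have Mo' : Ki + 0 + Dd + eps * Dv - PD + (Ca - Ft) = 0.
  apply: (eq_momentum_terms Mo); rewrite /Ki /Dd /Dv /PD /Ca /Ft.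
  - by [].
  - by rewrite /c_skw subrr.
  - by [].
  - by [].
  - by apply: intO_ext => x _; rewrite mulrC.
  - rewrite /ipv -intOB; last first.
    + by apply: tame_dotv => //; exact: tamevZ.
    + exact: tame_dotv.
    by apply: intO_ext => x _; rewrite dotvBl.
have P' : PD = - delta * Pr := P.
have S : T1 + Ki = 0 by move: E' Mo'; rewrite P'; lra.
have tE1 := tame_total_energy nn; have tE0 := tame_total_energy (ltnW nn).
have te1 := tame_energy_node nn; have te0 := tame_energy_node (ltnW nn).
have tu1 := Xh_tame (u_node nn); have tu0 := Xh_tame (u_node (ltnW nn)).
have tdu : tamev (fun x => tau^-1 *: dnode tau u n x).
  by apply: (tamevZ (tame_cst _ _ _)); exact: tamevB.
have : tau^-1 * intO a l (fun x => total_energy M tau phi theta u n.+1 x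
    - total_energy M tau phi theta u n x) = 0.
  rewrite -intOZ; last exact: tameB.
  rewrite -[RHS]S /T1 /Ki /ipv -intOD.
  - apply: intO_ext => x _; rewrite /total_energy /dnode /midnode.
    rewrite dotvZl dotvZr dotvBl ![dotv _ (_ + _)]dotvC !dotvDl.
    rewrite [dotv (u^[n.+1] x) (u^[n] x)]dotvC; field; rewrite gt_eqF //;
      exact: htau.
  - exact: (tameM (tame_cst _ _ _) (tameB te1 te0)).
  - exact: tame_dotv.
rewrite (intOB tE1 tE0).
exact: eq_of_scaled_sub htau.
Qed.

Let t_dphi : tame (dnode tau phi n) := Vh_tame a (dphi_Vh nn).
Let t_gdphi : tamev (grad (dnode tau phi n)) := tgrad (dphi_Vh nn).
Let t_gphi1 : tamev (grad phi^[n.+1]) := tgrad (phi_node nn).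
Let t_mu1 : tame mu^[n.+1] := Vh_tame a (mu_node nn).
Let t_phs : tame ph := Vh_tame a (phi_star nn).

(** Half of [convexity_density], written without intermediate points; in this
    form it is visibly measurable. *)
Definition remainder (k : nat) (x : V) : R :=
  theta_remainder M (phi^[k] x) (theta^[k] x) (theta^[k.+1] x)
  + vex_remainder M (phi^[k] x) (phi^[k.+1] x) (theta^[k.+1] x)
  + cav_remainder M (phi^[k] x) (phi^[k.+1] x) (theta^[k.+1] x).

Let t_th0 : tame theta^[n] := Vh_tame a (theta_node (ltnW nn)).1.

Lemma tame_remainder : tame (remainder n).
Proof.
have [CP _ CPt] := Psi_C2 hM; have [CV CVp _] := Psi_vex_C2 hM.
have [CC CCp _] := Psi_cav_C2 hM.
have h1 := phi_node nn; have h0 := phi_node (ltnW nn).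
have k1 := theta_node nn; have k0 := theta_node (ltnW nn).
have c2 (p t : V -> R) (F : R -> R -> R) : Vh l Th p -> Vh_pos l Th t ->
    C1_pos F -> tame (fun x => F (p x) (t x)).
  by move=> hp ht cF; apply: (tame_comp2 a hp ht) => q s s0;
    exact: C1_pos_continuous cF s0.
have dth : tame (fun x => theta^[n.+1] x - theta^[n] x) by exact: tameB.
apply: tameD; first apply: tameD.
- apply: tameB; last exact: c2 h0 k1 CP.
  apply: tameD; first exact: c2 h0 k0 CP.
  by apply: tameM => //; exact: c2 h0 k0 CPt.
- apply: tameD; first by apply: tameB; [exact: c2 h0 k1 CV|exact: c2 h1 k1 CV].
  by apply: tameM t_dphi; exact: c2 h1 k1 CVp.
- apply: tameB; last exact: c2 h1 k1 CC.
  apply: tameD; first exact: c2 h0 k1 CC.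
  by apply: tameM t_dphi; exact: c2 h0 k1 CCp.
Qed.

Lemma remainder_ge0 x : 0 <= remainder n x.
Proof.
have t0 := (theta_node (ltnW nn)).2 x.
have t1 := theta1_gt0 x.
apply: addr_ge0; first apply: addr_ge0.
- exact: (theta_remainder_ge0 hM _ t0 t1).
- exact: (vex_remainder_ge0 hM _ _ t1).
- exact: (cav_remainder_ge0 hM _ _ t1).
Qed.

Let split x := dphi_split M (phi^[n.+1] x) (phi^[n] x) (theta^[n.+1] x).

Let t_split : tame split.
Proof.
have [_ CVp _] := Psi_vex_C2 hM; have [_ CCp _] := Psi_cav_C2 hM.
have h1 := phi_node nn; have h0 := phi_node (ltnW nn); have k1 := theta_node nn.
apply: tameD.
  apply: (tame_comp2 a h1 k1 (F := dfst (Psi_vex M))) => q s s0.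
  exact: C1_pos_continuous CVp s0.
apply: (tame_comp2 a h0 k1 (F := dfst (Psi_cav M))) => q s s0.
exact: C1_pos_continuous CCp s0.
Qed.

Let de x := energy_node M tau phi theta n.+1 x - energy_node M tau phi theta n
  x.
Let t_de : tame de.
Proof. by apply: tameB; apply: tame_energy_node => //; exact: ltnW. Qed.

(** [potential_increment] together with
    |b|^2 - |a|^2 = 2 b.(b - a) - |b - a|^2 for the gradients of [phi].  The
    gradient of the increment of [phi] is the difference of the gradients only
    off a null set. *)
Lemma entropy_increment :
  intO a l (entropy_node M tau phi theta n.+1)
  - intO a l (entropy_node M tau phi theta n)
  = ips a l de theta^[n.+1] - ips a l split (dnode tau phi n)
    - gam M * ipv a l (grad phi^[n.+1]) (grad (dnode tau phi n))
    + gam M / 2 * ipv a l (grad (dnode tau phi n)) (grad (dnode tau phi n))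
    + intO a l (remainder n).
Proof.
have ts1 := tame_entropy_node nn; have ts0 := tame_entropy_node (ltnW nn).
have ta := tameM t_de t_theta1; have tb := tameM t_split t_dphi.
have tc := tame_dotv t_gphi1 t_gdphi; have td := tame_dotv t_gdphi t_gdphi.
have tc' := tameM (tame_cst a l (gam M)) tc.
have td' := tameM (tame_cst a l (gam M / 2)) td.
have tr := tame_remainder.
rewrite /ips /ipv -(intOB ts1 ts0) -(intOZ (gam M) tc) -(intOZ (gam M / 2) td).
have t2 := tameB ta tb; have t3 := tameB t2 tc'; have t4 := tameD t3 td'.
rewrite -(intOB ta tb) -(intOB t2 tc') -(intOD t3 td') -(intOD t4 tr).
have [N [mN N0 hN]] := grad_sub_ae hTh (phi_node nn) (phi_node (ltnW nn)).
apply: (intO_ae (tameB ts1 ts0) (tameD t4 tr) mN N0) => t Ot Nt;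
  have gE := hN t Ot Nt; move: (tuple_row t) gE => x gE.
have := potential_increment hM (phi^[n] x) (phi^[n.+1] x) (theta^[n] x)
  (theta1_gt0 x).
rewrite /entropy_node /entropy /de /energy_node /energy /split /dnode -/(dnode
  tau phi n).
rewrite (_ : grad (dnode tau phi n) x = grad phi^[n.+1] x - grad phi^[n] x) //.
rewrite !dotvBr !dotvBl [dotv (grad phi^[n] x) (grad phi^[n.+1] x)]dotvC.
rewrite /remainder; lra.
Qed.

Let Dvis := let f x := Num.sqrt (eta_ x * theta^[n.+1] x) *: symgrad (um n) x in
  ipm a l f f.
Let Ddiv := let f x := Num.sqrt (theta^[n.+1] x) * divg (um n) x in ips a l f f.
Let Dpi := let f x := (h * Num.sqrt (theta^[n.+1] x)) *: grad pi^[n.+1] x in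
  ipv a l f f.

Lemma eta_star_ge0 x : 0 <= eta_ x.
Proof. by apply: ltW; apply: (eta_gt0 hM); exact: (theta_star nn).2. Qed.

(** Test functions: the chemical potential in the phase equation, the increment
    of [phi] in the potential equation and the inverse temperature in the
    energy equation.  The last entropy-flux term then vanishes, and the
    transport and Korteweg terms cancel, the latter by symmetry of the
    stress. *)
Lemma entropy_step :
  intO a l (entropy_node M tau phi theta n.+1)
  - intO a l (entropy_node M tau phi theta n)
  = tau * dissipation M a l tau ts phi mu theta u n
    + (gam M / 2 * ipv a l (grad (dnode tau phi n)) (grad (dnode tau phi n))
       + intO a l (remainder n) + tau * eps * Ddiv + tau * delta * Dpi).
Proof.
have [Ph Po E _ _] :=
  scheme hsol nn (mu_node nn) (dphi_Vh nn) (theta_node nn) (um_Xh nn) (pi_node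
    nn).
pose S := ips a l de theta^[n.+1].
pose J := ipv a l (fun x => mulmv (L12_star M ts phi theta n x) (grad
  mu^[n.+1] x)
  - mulmv (L22_star M ts phi theta n x) (grad theta^[n.+1] x)) (grad
    theta^[n.+1]).
pose K := ipv a l (fun x => mulmv (L11_star M ts phi theta n x) (grad
  mu^[n.+1] x)
  - mulmv (L12_star M ts phi theta n x) (grad theta^[n.+1] x)) (grad mu^[n.+1]).
pose Sg := ipv a l (fun x => mulmv (sig x) (um n x)) (grad theta^[n.+1]).
pose C := ipv a l (fun x => ph x *: um n x) (grad mu^[n.+1]).
pose Q := ips a l (dnode tau phi n) mu^[n.+1].
have tL11 : tamem (L11_star M ts phi theta n).
  exact: (tamem_L11 hM hl hTh (phi_star nn) (theta_star nn)).
have tL12 : tamem (L12_star M ts phi theta n).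
  exact: (tamem_L12 hM hl hTh (phi_star nn) (theta_star nn)).
have tL22 : tamem (L22_star M ts phi theta n).
  exact: (tamem_L22 hM hl hTh (phi_star nn) (theta_star nn)).
have t_sig := tamem_sigma nn.
have E' : tau^-1 * S + J - Dvis - eps * Ddiv - delta * Dpi - Sg - (C - Sg) - 0
  = 0.
  apply: (eq_energy_terms E); rewrite /S /J /Dvis /Ddiv /Dpi /Sg /C /ips /ipm.
  - rewrite -intOZ; last exact: tameM.
    by apply: intO_ext => x _; rewrite mulrA.
  - by [].
  - apply: intO_ext => x _;
    rewrite [RHS]dotmZl [X in _ = _ * X]dotmZr [RHS]mulrA sqrt_mul_self.
      by ring.
    by rewrite mulr_ge0 ?eta_star_ge0 // ltW.
  - apply: intO_ext => x _; rewrite [RHS]mulrACA sqrt_mul_self; first by ring.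
    by rewrite ltW.
  - apply: intO_ext => x _.
    rewrite dotvZl dotvZr [RHS]mulrA [X in _ = X * _]mulrACA sqrt_mul_self.
      by ring.
    by rewrite ltW.
  - by [].
  - rewrite /ipv -intOB; last first.
    + by apply: tame_dotv => //; exact: tamev_mulmv.
    + by apply: tame_dotv => //; exact: tamevZ.
    apply: intO_ext => x _; rewrite /capillary_force /sigma_star /korteweg.
    move: (um n x) => w; rewrite dotvZr dotvBl !dotvZl !dotv_outer.
    rewrite [dotv w _]dotvC.
    by field; rewrite !gt_eqF //; exact: (theta_star nn).2.
  - by rewrite /ipv intO_eq0 // => x _; rewrite subrr scaler0 dotv0r.
have Ph' : tau^-1 * Q - C + K = 0.
  rewrite /Q /ips -intOZ; last exact: tameM.
  rewrite -[RHS]Ph /phase_eq; congr (_ + _ + _).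
  by rewrite /ips; apply: intO_ext => x _; rewrite mulrA.
have Po' : Q - gam M * ipv a l (grad phi^[n.+1]) (grad (dnode tau phi n))
    - ips a l split (dnode tau phi n) = 0.
  suff -> : Q = ips a l mu^[n.+1] (dnode tau phi n) by exact: Po.
  by rewrite /Q /ips; apply: intO_ext => x _; rewrite mulrC.
have DL : dissipation M a l tau ts phi mu theta u n = Dvis + (K - J).
  rewrite /dissipation -/Dvis; congr (_ + _); rewrite /K /J /ipv -intOB.
  - by apply: intO_ext => x _; exact: dotv_Lmat.
  - by apply: tame_dotv => //; apply: tamevB; exact: tamev_mulmv.
  - by apply: tame_dotv => //; apply: tamevB; exact: tamev_mulmv.
rewrite entropy_increment DL -/S.
have {}E' : S = tau * (Dvis + eps * Ddiv + delta * Dpi + C - J).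
  have -> : Dvis + eps * Ddiv + delta * Dpi + C - J = tau^-1 * S by move: E';
    lra.
  by rewrite mulrA divff ?mul1r // gt_eqF.
have {}Ph' : Q = tau * (C - K).
  have -> : C - K = tau^-1 * Q by move: Ph'; lra.
  by rewrite mulrA divff ?mul1r // gt_eqF.
exact: entropy_balance E' Ph' Po'.
Qed.

End Step.

(** The weights of the convex combinations are chosen as functions of the nodal
    values of [phi] and [theta], so that they inherit periodicity. *)
Lemma xi_exist : exists xi1 xi2 xi3 : nat -> V -> R, forall k, (k < nT)%N ->
  [/\ convex_combination l phi^[k] phi^[k.+1] (xi1 k),
      convex_combination l phi^[k] phi^[k.+1] (xi2 k),
      convex_combination l theta^[k] theta^[k.+1] (xi3 k) &
      forall x, convexity_density M tau phi theta (xi1 k) (xi2 k) (xi3 k) k x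
        = 2 * remainder k x].
Proof.
have /choice[f1 h1] : forall z : R * R * R, exists s : R, 0 < z.2 ->
    0 <= s <= 1 /\ vex_remainder M z.1.1 z.1.2 z.2 =
    dfst (dfst (Psi_vex M)) ((1 - s) * z.1.1 + s * z.1.2) z.2
      * (z.1.2 - z.1.1) ^+ 2 / 2.
  move=> [[p0 p1] t]; have [t0|_] := boolP (0 < t); last by exists 0.
  by have [s hs e] := vex_remainder_lagrange hM p0 p1 t0; exists s.
have /choice[f2 h2] : forall z : R * R * R, exists s : R, 0 < z.2 ->
    0 <= s <= 1 /\ cav_remainder M z.1.1 z.1.2 z.2 =
    - dfst (dfst (Psi_cav M)) ((1 - s) * z.1.1 + s * z.1.2) z.2
      * (z.1.2 - z.1.1) ^+ 2 / 2.
  move=> [[p0 p1] t]; have [t0|_] := boolP (0 < t); last by exists 0.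
  by have [s hs e] := cav_remainder_lagrange hM p0 p1 t0; exists s.
have /choice[f3 h3] : forall z : R * R * R, exists s : R,
    0 < z.1.2 -> 0 < z.2 ->
    0 <= s <= 1 /\ theta_remainder M z.1.1 z.1.2 z.2 =
    - dsnd (dsnd (Psi M)) z.1.1 ((1 - s) * z.1.2 + s * z.2)
      * (z.2 - z.1.2) ^+ 2 / 2.
  move=> [[p t] t']; have [t0|_] := boolP (0 < t); last by exists 0.
  have [t1|_] := boolP (0 < t'); last by exists 0.
  by have [s hs e] := theta_remainder_lagrange hM p t0 t1; exists s.
pose s1 k x := f1 (phi^[k] x, phi^[k.+1] x, theta^[k.+1] x).
pose s2 k x := f2 (phi^[k] x, phi^[k.+1] x, theta^[k.+1] x).
pose s3 k x := f3 (phi^[k] x, theta^[k] x, theta^[k.+1] x).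
exists (fun k x => (1 - s1 k x) * phi^[k] x + s1 k x * phi^[k.+1] x),
  (fun k x => (1 - s2 k x) * phi^[k] x + s2 k x * phi^[k.+1] x),
  (fun k x => (1 - s3 k x) * theta^[k] x + s3 k x * theta^[k.+1] x) => k kn.
have [_ pp0 _] := phi_node (ltnW kn); have [_ pp1 _] := phi_node kn.
have [[_ pt0 _] t0] := theta_node (ltnW kn).
have [[_ pt1 _] t1] := theta_node kn.
split.
- split => [i x|x]; first by rewrite /s1 pp0 pp1 pt1.
  by exists (s1 k x) => //; exact: (h1 (_, _, _) (t1 x)).1.
- split => [i x|x]; first by rewrite /s2 pp0 pp1 pt1.
  by exists (s2 k x) => //; exact: (h2 (_, _, _) (t1 x)).1.
- split => [i x|x]; first by rewrite /s3 pp0 pt0 pt1.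
  by exists (s3 k x) => //; exact: (h3 (_, _, _) (t0 x) (t1 x)).1.
move=> x; rewrite /remainder /convexity_density /dnode.
rewrite (h1 (_, _, _) (t1 x)).2 (h2 (_, _, _) (t1 x)).2.
rewrite (h3 (_, _, _) (t0 x) (t1 x)).2; exact: half_sum.
Qed.

End Scheme.

(** * Conservation and entropy production *)

Section CubeIntegrals.
Context (R : realType) (d : nat) (a : 'rV[R]_d) (l : R).
Local Notation V := 'rV[R]_d.

Lemma ips_increment (f g : V -> R) : tame a l f -> tame a l g ->
  ips a l (fun x => f x - g x) (fun=> 1) = intO a l f - intO a l g.
Proof.
move=> tf tg; rewrite -(intOB tf tg) /ips; apply: intO_ext => x _.
exact: mulr1.
Qed.

Lemma ips_ge0 (f : V -> R) : 0 <= ips a l f f.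
Proof. by apply: intO_ge0 => x _; rewrite -[f x * f x]expr2;
  exact: sqr_ge0. Qed.

Lemma ipv_ge0 (f : V -> V) : 0 <= ipv a l f f.
Proof. by apply: intO_ge0 => x _; exact: dotv_ge0. Qed.

End CubeIntegrals.

Lemma telescope_constant (T : Type) (I : nat -> T) (N : nat) :
  (forall k, (k < N)%N -> I k.+1 = I k) -> forall n, (n <= N)%N -> I n = I 0%N.
Proof.
by move=> H; elim=> // n IH nN; rewrite H // IH // ltnW.
Qed.

Theorem theorem2p4 (R : realType) (d : nat) (hd : d = 2%N \/ d = 3%N)
    (M : model R d) (hM : model_assumptions M)
    (a : 'rV[R]_d) (l : R) (hl : 0 < l)
    (Th : {fset {fset 'rV[R]_d}}) (hTh : periodic_conforming_mesh a l Th)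
    (eps delta : R) (heps : 0 < eps) (hdelta : 0 < delta)
    (T tau : R) (nT : nat) (hT : 0 < T) (htau : 0 < tau) (hnT : T = nT%:R * tau)
    (ts : nat -> R)
    (hts : forall n, (n < nT)%N -> n%:R * tau <= ts n <= n.+1%:R * tau)
    (phi0 theta0 : 'rV[R]_d -> R) (u0 : 'rV[R]_d -> 'rV[R]_d)
    (hphi0 : Vh l Th phi0) (hu0 : Xh l Th u0) (htheta0 : Vh_pos l Th theta0)
    (phi mu theta pi : R -> 'rV[R]_d -> R) (u : R -> 'rV[R]_d -> 'rV[R]_d)
    (hsol : discrete_solution M a l Th eps delta tau nT ts phi mu theta pi u
              phi0 theta0 u0) :
  exists xi1 xi2 xi3 : nat -> 'rV[R]_d -> R,
    let Dnum k := numerical_dissipation M a l Th eps delta tau phi theta pi u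
                    (xi1 k) (xi2 k) (xi3 k) k in
    (forall k, (k < nT)%N ->
      [/\ convex_combination l (node tau phi k) (node tau phi k.+1) (xi1 k),
          convex_combination l (node tau phi k) (node tau phi k.+1) (xi2 k),
          convex_combination l (node tau theta k) (node tau theta k.+1) (xi3 k),
          integrableO a l
            (convexity_density M tau phi theta (xi1 k) (xi2 k) (xi3 k) k)
        & 0 <= Dnum k]) /\
    forall n, (n < nT)%N ->
      [/\ ips a l (fun x => node tau phi n.+1 x - node tau phi 0 x) (fun=> 1)
            = 0,
          ips a l (fun x => total_energy M tau phi theta u n.+1 x
                            - total_energy M tau phi theta u 0 x) (fun=> 1)
            = 0
        & ips a l (fun x => entropy_node M tau phi theta n.+1 x
                            - entropy_node M tau phi theta 0 x) (fun=> 1)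
            = tau * \sum_(0 <= k < n.+1)
                      dissipation M a l tau ts phi mu theta u k
              + \sum_(0 <= k < n.+1) Dnum k].
Proof.
have [xi1 [xi2 [xi3 Hxi]]] := xi_exist hM htau hsol.
have tphi := phi_node htau hsol.
have tE := tame_total_energy hM htau hsol.
have tS := tame_entropy_node hM hl hTh htau hsol.
have rem_tame k (kn : (k < nT)%N) := tame_remainder hM htau hsol kn.
have rem_ge0 k (kn : (k < nT)%N) := remainder_ge0 hM htau hsol kn.
have half_density k : (k < nT)%N ->
    2^-1 * intO a l (convexity_density M tau phi theta (xi1 k) (xi2 k) (xi3 k)
      k)
    = intO a l (remainder M tau phi theta k).
  move=> kn; have [_ _ _ D] := Hxi k kn.
  rewrite -[RHS](@mulKf _ 2) ?pnatr_eq0 //; congr (_ * _).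
  rewrite -(intOZ 2 (rem_tame k kn)); apply: intO_ext => x _; exact: D.
exists xi1, xi2, xi3; split=> [k kn|n nn].
  have [c1 c2 c3 D] := Hxi k kn; split=> //.
    apply: tame_integrable.
    by apply: tame_ext (tameM (tame_cst a l 2) (rem_tame k kn)) => x _.
  have I0 : 0 <= intO a l (remainder M tau phi theta k).
    by apply: intO_ge0 => x _; exact: rem_ge0.
  rewrite /numerical_dissipation half_density //.
  rewrite !addr_ge0 // mulr_ge0 ?ips_ge0 ?ipv_ge0 ?mulr_ge0 ?invr_ge0 ?ltW //.
  exact: (gam_gt0 hM).
split.
- rewrite ips_increment;
  [|exact: Vh_tame (tphi _ nn)|exact: Vh_tame (tphi _ _)].
  rewrite (telescope_constant (mass_step htau hsol) nn) subrr //.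
- rewrite ips_increment; [|exact: tE|exact: tE].
  rewrite (telescope_constant (total_energy_step hM hl hTh htau hts hsol) nn).
  by rewrite subrr.
rewrite ips_increment; [|exact: tS|exact: tS].
rewrite mulr_sumr -big_split /=.
rewrite -(@telescope_sumr _ 0 n.+1
  (fun k => intO a l (entropy_node M tau phi theta k))) //.
apply: eq_big_nat => k /andP[_ kn].
have kT : (k < nT)%N by exact: leq_trans kn nn.
rewrite (entropy_step hM hl hTh htau hts hsol kT) /numerical_dissipation.
by rewrite half_density.
Qed.
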